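(* Let $(M,F)$ be a Finsler manifold admitting a concurrent $\pi$-vector field $\overline{\varphi}$ with associated $\pi$-form $\phi=i_{\overline{\varphi}}g$; put $\Phi=\phi(\overline{\eta})=g(\overline\varphi,\overline\eta)$ and $p^2=g(\overline\varphi,\overline\varphi)$. Let $\widehat F=\frac{F^2}{F-\Phi}$ on $\mathcal D=\{(x,y)\in TM : F(x,y)>\Phi(x,y)\}$ be a generalized $\phi$-Matsumoto metric (i.e. a conic pseudo-Finsler structure), with $F(1+2p^2)-3\Phi\ne0$ on $\mathcal D$. If $G$ is the geodesic spray of $F$, then the geodesic spray $\widehat G$ of $\widehat F$ is given on $\mathcal D$ by $$\widehat G=G-f_1\,\mathcal C+f_2\,\gamma\overline\varphi,\qquad f_1:=\frac{F(4\Phi-F)}{F(1+2p^2)-3\Phi},\quad f_2:=\frac{2F^3}{F(1+2p^2)-3\Phi}.$$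
   Context: Setting. $M$ is an $n$-dimensional paracompact smooth manifold, $\pi:TM\to M$ its tangent bundle, $\mathcal TM=TM\setminus\{0\}$ the slit tangent bundle. $\pi$-vector fields are smooth sections of the pullback of the bundle $TM\to M$ over $\mathcal TM$ (local basis $\overline{\partial}_i$); $\pi$-forms/tensors are the corresponding (dual) tensor sections. $\gamma$ is the natural injection (vertical lift) $\gamma(W^i\overline\partial_i)=W^i\partial_{y^i}$, $\rho(a^i\partial_{x^i}+b^i\partial_{y^i})=a^i\overline\partial_i$, $J=\gamma\circ\rho$, $\overline\eta(u)=(u,u)$ (i.e. $\overline\eta=y^i\overline\partial_i$), $\mathcal C=\gamma\overline\eta$ is the Liouville field, and $d_Jf=df\circ J$ for functions $f$. Finsler structure: $F:TM\to[0,\infty)$, $C^\infty$ on $\mathcal TM$, $C^0$ on $TM$, positively homogeneous of degree 1 in $y$, with $dd_JE$ of maximal rank, $E=\frac12F^2$. Metric tensor: $g(\rho W,\rho Z)=dd_JE(JW,Z)$ (it is positive definite). Geodesic spray $G$: the vector field with $JG=\mathcal C$, $[\mathcal C,G]=G$, $i_Gdd_JE=-dE$. Barthel connection $\Gamma=[J,G]$ (i.e. $\Gamma X=[JX,G]-J[X,G]$), projectors $h=\frac12(I+\Gamma)$, $v=\frac12(I-\Gamma)$, horizontal map $\beta=(\rho|_{\mathrm{Im}\,h})^{-1}$. Berwald connection $D^\circ$: $\gamma D^\circ_{hZ}\rho W=v[hZ,JW]$, $D^\circ_{\gamma\overline Z}\overline W=\rho[\gamma\overline Z,\beta\overline W]$.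 Cartan connection $\nabla$: determined by $2g(\nabla_{\gamma\overline X}\overline Y,\overline Z)=\gamma\overline X\cdot g(\overline Y,\overline Z)+g(\overline Y,\rho[\beta\overline Z,\gamma\overline X])+g(\overline Z,\rho[\gamma\overline X,\beta\overline Y])$ and $2g(\nabla_{\beta\overline X}\overline Y,\overline Z)=\beta\overline X\cdot g(\overline Y,\overline Z)+\beta\overline Y\cdot g(\overline Z,\overline X)-\beta\overline Z\cdot g(\overline X,\overline Y)-g(\overline X,\rho[\beta\overline Y,\beta\overline Z])+g(\overline Y,\rho[\beta\overline Z,\beta\overline X])+g(\overline Z,\rho[\beta\overline X,\beta\overline Y])$. Concurrent $\pi$-vector field: a non-vanishing $\pi$-vector field $\overline\varphi$ with $\nabla_{\beta\overline W}\overline\varphi=-\overline W=D^\circ_{\beta\overline W}\overline\varphi$ and $\nabla_{\gamma\overline W}\overline\varphi=0=D^\circ_{\gamma\overline W}\overline\varphi$ for all $\overline W$. Conic pseudo-Finsler structure on $M$: a smooth function to $[0,\infty)$ on a conic sub-bundle $\mathcal D\subset\mathcal TM$ (non-empty, open, invariant under scaling by positive reals, $\pi(\mathcal D)=M$, each fibre $\mathcal D_x$ connected), positively 1-homogeneous in $y$, whose form $dd_J(\frac12(\cdot)^2)$ has maximal rank. For the conic pseudo-Finsler structure $\widehat F$, the energy $\widehat E=\frac12\widehat F^2$, metric tensor $\widehat g$, geodesic spray $\widehat G$, Barthel connection $\widehat\Gamma$, projectors $\widehat h,\widehat v$, horizontal map $\widehat\beta$, Berwald connection $\widehat D^\circ$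 and Cartan connection $\widehat\nabla$ are defined on $\mathcal D$ by the same formulas as the corresponding unhatted objects of $F$. *)

(* Defs.v *)
From HB Require Import structures.
From mathcomp Require Import all_boot all_order all_algebra.
From mathcomp Require Import boolp classical_sets functions cardinality reals.
From mathcomp Require Import topology normedtype derive.

Set Implicit Arguments.
Unset Strict Implicit.
Unset Printing Implicit Defensive.

Import Order.TTheory GRing.Theory Num.Theory.
Import numFieldNormedType.Exports.

Local Open Scope classical_set_scope.
Local Open Scope ring_scope.

Section SmoothFunctions.
Context {R : realType} {V W : normedModType R}.

Fixpoint Ck (k : nat) (U : set V) (f : V -> W) : Prop :=
  match k with
  | 0 => forall x, U x -> {for x, continuous f}
  | k'.+1 => (forall x, U x -> differentiable f x) /\
             (forall v, Ck k' U (fun x => 'D_v f x))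
  end.

(* Meant for open [U] *)
Definition smooth_on (U : set V) (f : V -> W) : Prop := forall k, Ck k U f.

End SmoothFunctions.

Definition paracompact (X : topologicalType) : Prop :=
  forall U : set (set X),
    U `<=` open -> \bigcup_(A in U) A = setT ->
    exists V : set (set X),
      [/\ V `<=` open,
          \bigcup_(B in V) B = setT,
          forall B, V B -> exists2 A, U A & B `<=` A &
          forall x : X, exists2 N : set X, nbhs x N &
            finite_set [set B | V B /\ B `&` N !=set0]].

(* [param i] is only relevant on [coord i @` dom i], [coord i] on [dom i].
   The chart [chart_at x] chosen around each point serves to represent the
   abstract tangent space at [x] by its coordinates in that chart. *)
Record smoothManifold (R : realType) (n : nat) := SmoothManifold {
  carrier :> topologicalType;
  chart : Type;
  dom : chart -> set carrier;
  coord : chart -> carrier -> 'rV[R]_n;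
  param : chart -> 'rV[R]_n -> carrier;
  chart_at : carrier -> chart;
  carrier_hausdorff : hausdorff_space carrier;
  carrier_paracompact : paracompact carrier;
  mem_chart_at : forall x, dom (chart_at x) x;
  dom_open : forall i, open (dom i);
  codom_open : forall i, open (coord i @` dom i);
  coordK : forall i x, dom i x -> param i (coord i x) = x;
  coord_continuous : forall i x, dom i x -> {for x, continuous (coord i)};
  param_continuous : forall i p, (coord i @` dom i) p ->
    {for p, continuous (param i)};
  transition_smooth : forall i j,
    smooth_on (coord i @` (dom i `&` dom j)) (coord j \o param i)
}.

(* The geometry of the tangent bundle inside one natural chart (x, y) of TM:
   points and tangent vectors (a, b) = a^i d/dx^i + b^i d/dy^i are elements of
   'rV_(n + n); a vector field is a map 'rV_(n + n) -> 'rV_(n + n) and a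
   pi-vector field W^i \bar\partial_i a map 'rV_(n + n) -> 'rV_n. *)
Section NaturalChart.
Context {R : realType} {n : nat}.
Local Notation pt := 'rV[R]_(n + n).
Local Notation vec := 'rV[R]_(n + n).
Local Notation pivec := 'rV[R]_n.

Definition gam (w : pivec) : vec := row_mx 0 w.
Definition rho (a : vec) : pivec := lsubmx a.
Definition Jv (a : vec) : vec := gam (rho a).
Definition eta (p : pt) : pivec := rsubmx p.
Definition Liouville (p : pt) : vec := gam (eta p).

Definition lie (X Y : pt -> vec) (p : pt) : vec :=
  'd Y p (X p) - 'd X p (Y p).

(* Exterior derivative of a 1-form, evaluated on a pair of tangent vectors:
   d w (X, Y) = X (w Y) - Y (w X) - w [X, Y] with X, Y the constant (hence
   commuting) coordinate extensions of [a] and [b]. *)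
Definition dext (w : pt -> vec -> R) (p : pt) (a b : vec) : R :=
  'd (fun q => w q b) p a - 'd (fun q => w q a) p b.

Definition dJ (f : pt -> R) (p : pt) (a : vec) : R := 'd f p (Jv a).

Definition ddJ (f : pt -> R) : pt -> vec -> vec -> R := dext (dJ f).

Definition maximal_rank (w : vec -> vec -> R) : Prop :=
  \rank (\matrix_(i < n + n, j < n + n) w (delta_mx 0 i) (delta_mx 0 j))
  = (n + n)%N.

(* g (rho w, rho z) = dd_J E (J w, z), with the lifts w = (a, 0), z = (b, 0) *)
Definition metric (E : pt -> R) (p : pt) (a b : pivec) : R :=
  ddJ E p (Jv (row_mx a 0)) (row_mx b 0).

Section Spray.
Variable G : pt -> vec.

Definition Barthel (X : pt -> vec) (p : pt) : vec :=
  lie (Jv \o X) G p - Jv (lie X G p).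

Definition hproj (X : pt -> vec) (p : pt) : vec := 2^-1 *: (X p + Barthel X p).
Definition vproj (X : pt -> vec) (p : pt) : vec := 2^-1 *: (X p - Barthel X p).

(* The inverse of rho restricted to the image of h: as h kills vertical fields
   and rho \o h = rho, it sends W to h X for any X with rho X = W. *)
Definition beta (W : pt -> pivec) : pt -> vec :=
  hproj (fun p => row_mx (W p) 0).

Let gammaf (W : pt -> pivec) : pt -> vec := gam \o W.

(* D_{beta W} Y and D_{gamma W} Y for the Berwald connection.  The field
   v [beta W, gamma Y] = gamma (D_{beta W} Y) being vertical, its preimage by
   gamma is its y-component. *)
Definition Berwald_hor (W Y : pt -> pivec) (p : pt) : pivec :=
  rsubmx (vproj (lie (beta W) (gammaf Y)) p).
Definition Berwald_ver (W Y : pt -> pivec) (p : pt) : pivec :=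
  rho (lie (gammaf W) (beta Y) p).

(* [nh X Y] and [nv X Y] are nabla_{beta X} Y and nabla_{gamma X} Y for the
   Cartan connection of E over the open set U. *)
Definition is_Cartan (U : set pt) (E : pt -> R)
    (nh nv : (pt -> pivec) -> (pt -> pivec) -> (pt -> pivec)) : Prop :=
  let g (Y Z : pt -> pivec) p := metric E p (Y p) (Z p) in
  let app (X : pt -> vec) (f : pt -> R) p : R := 'd f p (X p) in
  let br (X Y : pt -> vec) p := rho (lie X Y p) in
  forall X Y Z : pt -> pivec,
    smooth_on U X -> smooth_on U Y -> smooth_on U Z ->
    forall p, U p ->
    2 * g (nv X Y) Z p =
      app (gammaf X) (g Y Z) p
      + g Y (br (beta Z) (gammaf X)) p
      + g Z (br (gammaf X) (beta Y)) p
    /\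
    2 * g (nh X Y) Z p =
      app (beta X) (g Y Z) p
      + app (beta Y) (g Z X) p
      - app (beta Z) (g X Y) p
      - g X (br (beta Y) (beta Z)) p
      + g Y (br (beta Z) (beta X)) p
      + g Z (br (beta X) (beta Y)) p.

(* The concurrency equations over the open set U; the Cartan connection
   exists and is uniquely determined by [is_Cartan]. *)
Definition concurrent_on (U : set pt) (E : pt -> R) (phi : pt -> pivec) : Prop :=
  exists nh nv, is_Cartan U E nh nv /\
    forall W, smooth_on U W -> forall p, U p ->
      [/\ nh W phi p = - W p,
          Berwald_hor W phi p = - W p,
          nv W phi p = 0 &
          Berwald_ver W phi p = 0].

End Spray.

End NaturalChart.

Section TangentBundle.
Context {R : realType} {n : nat} (M : smoothManifold R n).

(* Components, in the chart i, of the tangent vector at x whose components in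
   the chart [chart_at x] are v. *)
Definition tangent_coord (i : chart M) (x : M) (v : 'rV[R]_n) : 'rV[R]_n :=
  'd (coord i \o param (chart_at x)) (coord (chart_at x) x) v.

(* (x, v) is the tangent vector at x with components v in [chart_at x]. *)
Definition TM : Type := (M * 'rV[R]_n)%type.

Definition TM_coord (i : chart M) (u : TM) : 'rV[R]_(n + n) :=
  row_mx (coord i u.1) (tangent_coord i u.1 u.2).

Definition TM_param (i : chart M) (p : 'rV[R]_(n + n)) : TM :=
  let x := param i (lsubmx p) in
  (x, 'd (coord (chart_at x) \o param i) (lsubmx p) (rsubmx p)).

Definition TM_chart (u : TM) : chart M := chart_at u.1.

(* The part of A lying over [dom i], read in the natural chart of TM. *)
Definition in_chart (i : chart M) (A : set TM) : set 'rV[R]_(n + n) :=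
  [set p | (coord i @` dom i) (lsubmx p) /\ A (TM_param i p)].

Definition TM_open (A : set TM) : Prop := forall i, open (in_chart i A).

Definition slit : set TM := [set u | u.2 != 0].

Definition scale (t : R) (u : TM) : TM := (u.1, t *: u.2).

Definition loc_fun (f : TM -> R) (i : chart M) : 'rV[R]_(n + n) -> R :=
  f \o TM_param i.

(* A pi-vector field maps u to an element of T_(pi u) M, given by its
   components in [chart_at (pi u)]. *)
Definition pifield : Type := TM -> 'rV[R]_n.

Definition loc_pifield (W : pifield) (i : chart M) (p : 'rV[R]_(n + n)) :
    'rV[R]_n :=
  let u := TM_param i p in tangent_coord i u.1 (W u).

(* A vector field on TM maps u to an element of T_u TM, given by its components
   in the natural chart of TM induced by [chart_at (pi u)]. *)
Definition vfield : Type := TM -> 'rV[R]_(n + n).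

Definition loc_vfield (X : vfield) (i : chart M) (p : 'rV[R]_(n + n)) :
    'rV[R]_(n + n) :=
  let u := TM_param i p in
  'd (TM_coord i \o TM_param (TM_chart u)) (TM_coord (TM_chart u) u) (X u).

Definition smooth_fun (A : set TM) (f : TM -> R) : Prop :=
  forall i, smooth_on (in_chart i A) (loc_fun f i).
Definition smooth_pifield (A : set TM) (W : pifield) : Prop :=
  forall i, smooth_on (in_chart i A) (loc_pifield W i).
Definition smooth_vfield (A : set TM) (X : vfield) : Prop :=
  forall i, smooth_on (in_chart i A) (loc_vfield X i).

Definition etaM : pifield := fun u => u.2.
Definition gamM (W : pifield) : vfield := fun u => gam (W u).
Definition LiouvilleM : vfield := gamM etaM.

Definition energy (F : TM -> R) : TM -> R := fun u => 2^-1 * F u ^+ 2.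

Definition energy_rank (A : set TM) (F : TM -> R) : Prop :=
  forall i p, in_chart i A p -> maximal_rank (ddJ (loc_fun (energy F) i) p).

Definition finsler (F : TM -> R) : Prop :=
  [/\ forall u, 0 <= F u,
      smooth_fun slit F,
      forall i p, in_chart i setT p -> {for p, continuous (loc_fun F i)},
      forall u t, 0 < t -> F (scale t u) = t * F u &
      energy_rank slit F].

Definition conic (D : set TM) : Prop :=
  [/\ D `<=` slit,
      D !=set0,
      TM_open D,
      forall u t, 0 < t -> D u -> D (scale t u) &
      fst @` D = setT /\
      forall x : M, connected [set v : 'rV[R]_n | D (x, v)]].

Definition conic_pseudo_finsler (D : set TM) (F : TM -> R) : Prop :=
  [/\ conic D,
      forall u, D u -> 0 <= F u,
      smooth_fun D F,
      forall u t, 0 < t -> D u -> F (scale t u) = t * F u &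
      energy_rank D F].

(* g_u (Y, Z) *)
Definition metricM (F : TM -> R) (Y Z : pifield) (u : TM) : R :=
  let i := TM_chart u in
  metric (loc_fun (energy F) i) (TM_coord i u) (Y u) (Z u).

Definition geodesic_spray (A : set TM) (F : TM -> R) (G : vfield) : Prop :=
  smooth_vfield A G /\
  forall i p, in_chart i A p ->
    let E := loc_fun (energy F) i in
    let Gi := loc_vfield G i in
    [/\ Jv (Gi p) = Liouville p,
        lie Liouville Gi p = Gi p &
        forall a, ddJ E p (Gi p) a = - 'd E p a].

(* G is the geodesic spray of F *)
Definition concurrent (F : TM -> R) (G : vfield) (phi : pifield) : Prop :=
  [/\ smooth_pifield slit phi,
      forall u, slit u -> phi u != 0 &
      forall i, concurrent_on (loc_vfield G i) (in_chart i slit)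
        (loc_fun (energy F) i) (loc_pifield phi i)].

End TangentBundle.

Arguments slit {R n M}.
Arguments etaM {R n M}.
Arguments LiouvilleM {R n M}.

(* Main.v *)
(* In a natural chart write [D_v] for the derivative along a constant vector [v],
   and, for b in R^n, [gam b] = (0, b) and [hor b] = (b, 0).  A field [G] with
   [JG = C] and [D_G (D_(gam b) E) = D_(hor b) E] for all b satisfies
   [i_G dd_J E = - dE] by Euler's identity, and the maximal rank of dd_J makes
   such a [G] unique, so it suffices to check this Euler-Lagrange equation for
   the asserted field and the energy of [F^2 / (F - Phi)].

   The vertical concurrency equations say that phi and the 1-form [g(phi, -)]
   do not depend on y.  The horizontal Cartan equation for the vectors (w, z)
   minus the one for (z, w) shows that this 1-form on M is closed, and its
   diagonal case w = z = y gives [G(Phi) = - F^2].  With [G(F) = 0],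
   homogeneity, and Euler-Lagrange for E and Phi along G, every derivative that
   occurs in the equation is explicit, and the latter becomes an identity of
   rational functions. *)
Require Import Defs.
From HB Require Import structures.
From mathcomp Require Import all_boot all_order all_algebra.
From mathcomp Require Import boolp classical_sets functions cardinality reals.
From mathcomp Require Import topology normedtype landau derive.
From mathcomp Require Import ring lra.
Import Order.TTheory GRing.Theory Num.Theory.
Import numFieldNormedType.Exports.

Local Open Scope classical_set_scope.
Local Open Scope ring_scope.

Set Implicit Arguments.
Unset Strict Implicit.
Unset Printing Implicit Defensive.

(** A directional derivative only sees its function along one line. This lets vertical derivatives
    be compared across charts without a chain rule. *)
Lemma derive_eq_line (R : realType) (V V' W : normedModType R)
    (f : V -> W) (g : V' -> W) x v x' v' :
  (forall h, f (h *: v + x) = g (h *: v' + x')) -> 'D_v f x = 'D_v' g x'.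
Proof.
move=> fg; have := fg 0; rewrite !scale0r !add0r => fg0.
rewrite /derive; congr (lim (_ @ 0^')); apply/funext => h /=.
by rewrite fg fg0.
Qed.

(* Otherwise unification of two distinct derivatives unfolds them to limits. *)
Opaque derive diff.

(** * Functions of class C^k *)

Section Differentiation.
Context {R : realType} {V W : normedModType R}.
Implicit Types (f g : V -> W) (U : set V).

Lemma open_near_eq U f g x : open U -> U x -> {in U, f =1 g} ->
  \forall y \near x, f y = g y.
Proof.
move=> oU Ux fg; apply: filterS (open_nbhs_nbhs (conj oU Ux)) => y Uy.
by apply: fg; rewrite inE.
Qed.

(** The first-order expansion of [f] at [x] is also one for [g], and [diff_unique] identifies its
    linear part with the differential of [g]. *)
Lemma near_eq_differentiable f g x :
  (\forall y \near x, f y = g y) -> differentiable f x -> differentiable g x.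
Proof.
move=> fg /diff_locallyP [cdf fE].
have gE : g \o shift x = cst (g x) + 'd f x +o_ 0 id.
  apply/eqaddoP => e e0; move/eqaddoP: fE => /(_ e e0).
  have fg0 : \forall h \near 0, f (h + x) = g (h + x).
    move: fg; rewrite (near_shift 0 x).
    by apply: filterS => h /=; rewrite subr0.
  have fgx : f x = g x := nbhs_singleton fg.
  by apply: filter_app; near=> h; rewrite !fctE /= fgx (near fg0 h).
have dfg := diff_unique cdf gE.
by apply/diff_locallyP; rewrite dfg; split.
Unshelve. all: by end_near. Qed.

(** Openness of [U] turns equality on [U] into equality of germs at each of its points, which
    derivatives of every order respect. *)
Lemma Ck_eq k U f g : open U -> {in U, f =1 g} -> Ck k U f -> Ck k U g.
Proof.
move=> oU; elim: k f g => [|k IHk] f g fg.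
  move=> cf x Ux; have fgx := open_near_eq oU Ux fg.
  suff : g @ x --> g x by [].
  rewrite -(nbhs_singleton fgx); apply: cvg_trans (cf x Ux).
  exact: near_eq_cvg.
move=> [df Cf]; split=> [x Ux|v].
  exact: near_eq_differentiable (open_near_eq oU Ux fg) (df _ Ux).
apply: IHk (Cf v) => x; rewrite inE => Ux.
exact: near_eq_derive (open_near_eq oU Ux fg).
Unshelve. all: by end_near. Qed.

Lemma CkW k U f : Ck k.+1 U f -> Ck k U f.
Proof.
elim: k f => [|k IHk] f [df Cf].
  by move=> x Ux; exact/differentiable_continuous/df.
by split=> // v; apply: IHk.
Qed.

Lemma Ck_cst k U (c : W) : Ck k U (fun=> c).
Proof.
elim: k c => [|k IHk] c; first by move=> x _; exact: cvg_cst.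
split=> [x _|v]; first exact: differentiable_cst.
suff -> : 'D_v (fun _ : V => c) = (fun=> 0 : W) by [].
by apply/funext => x; exact: derive_cst.
Qed.

Lemma CkD k U f g : open U -> Ck k U f -> Ck k U g ->
  Ck k U (fun x => f x + g x).
Proof.
move=> oU; elim: k f g => [|k IHk] f g.
  by move=> cf cg x Ux; apply: cvgD; [exact: cf|exact: cg].
move=> [df Cf] [dg Cg]; split=> [x Ux|v].
  exact: differentiableD (df _ Ux) (dg _ Ux).
apply: (Ck_eq oU _ (IHk _ _ (Cf v) (Cg v))) => x; rewrite inE => Ux.
by rewrite -deriveD //; apply: diff_derivable; [exact: df|exact: dg].
Qed.

Lemma smooth_differentiable U f x : smooth_on U f -> U x -> differentiable f x.
Proof. by move=> sf; have [] := sf 1%N => df _; exact: df. Qed.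

Lemma smooth_derive U f v : smooth_on U f -> smooth_on U ('D_v f).
Proof. by move=> sf k; have [_] := sf k.+1; exact. Qed.

Lemma Ck_subset k U U' f : U' `<=` U -> Ck k U f -> Ck k U' f.
Proof.
move=> sUU'; elim: k f => [|k IHk] f; first by move=> cf x /sUU'/cf.
by move=> [df Cf]; split=> [x /sUU'/df|v] //; apply: IHk; apply: Cf.
Qed.

Lemma smooth_subset U U' f : U' `<=` U -> smooth_on U f -> smooth_on U' f.
Proof. by move=> sUU' sf k; exact: Ck_subset sUU' (sf k). Qed.

Lemma smooth_cst U (c : W) : smooth_on U (fun=> c).
Proof. by move=> k; exact: Ck_cst. Qed.

End Differentiation.

Section ScalarFunctions.
Context {R : realType} {V : normedModType R}.
Implicit Types (f g : V -> R) (U : set V).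

Lemma CkM k U f g : open U -> Ck k U f -> Ck k U g ->
  Ck k U (fun x => f x * g x).
Proof.
move=> oU; elim: k f g => [|k IHk] f g.
  by move=> cf cg x Ux; apply: cvgM; [exact: cf|exact: cg].
move=> Cf' Cg'; have [Cfk Cgk] := (CkW Cf', CkW Cg').
have [[df Cf] [dg Cg]] := (Cf', Cg'); split=> [x Ux|v].
  exact: differentiableM (df _ Ux) (dg _ Ux).
have := CkD oU (IHk _ _ Cfk (Cg v)) (IHk _ _ Cgk (Cf v)).
apply: Ck_eq => // x; rewrite inE => Ux.
by rewrite -deriveM //; apply: diff_derivable; [exact: df|exact: dg].
Qed.

Lemma smooth_half_square U f : open U -> smooth_on U f ->
  smooth_on U (fun x => 2^-1 * f x ^+ 2).
Proof.
move=> oU sf k; apply: CkM => //; first exact: Ck_cst.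
by apply: CkM.
Qed.

Lemma is_derive_line f x u s : differentiable f (x + s *: u) ->
  is_derive s 1 (fun r => f (x + r *: u)) ('D_u f (x + s *: u)).
Proof.
move=> df; have dl : is_diff s (fun r : R => x + r *: u) ( *:%R^~ u).
  by apply: is_diff_eq; rewrite add0r.
have dc : differentiable (f \o (fun r : R => x + r *: u)) s.
  exact: differentiable_comp.
apply: DeriveDef; first exact: (diff_derivable dc).
by rewrite (deriveE _ dc) diff_comp // diff_val /= scale1r deriveE.
Qed.

Lemma mean_value_line f x u t : 0 <= t ->
  (forall s, s \in `[0, t] -> differentiable f (x + s *: u)) ->
  exists2 s, s \in `[0, t] &
    f (x + t *: u) - f x = t * 'D_u f (x + s *: u).
Proof.
move=> t0 df.
have dl s : s \in `[0, t] ->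
    is_derive s 1 (fun r => f (x + r *: u)) ('D_u f (x + s *: u)).
  by move=> /df; exact: is_derive_line.
have dgl s : s \in `]0, t[ ->
    is_derive s 1 (fun r => f (x + r *: u)) ('D_u f (x + s *: u)).
  by move=> st; apply: dl; exact: subset_itv_oo_cc st.
have cl : {within `[0, t], continuous (fun r => f (x + r *: u))}.
  by apply: derivable_within_continuous => s /dl [].
have [c ct] := MVT_segment t0 dgl cl.
by rewrite scale0r addr0 subr0 mulrC => E; exists c.
Qed.

(** The mean value theorem is used twice: along [u] for the increment of [f] by [t *: v], then along
    [v] for the derivative of [f] in direction [u]. *)
Lemma second_difference U f u v x t : Ck 2 U f -> 0 <= t ->
  (forall s r, s \in `[0, t] -> r \in `[0, t] -> U (x + s *: u + r *: v)) ->
  exists2 y, exists s r, [/\ s \in `[0, t], r \in `[0, t] &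
      y = x + s *: u + r *: v] &
    f (x + t *: u + t *: v) - f (x + t *: u) - (f (x + t *: v) - f x) =
    t * (t * 'D_v ('D_u f) y).
Proof.
move=> [df Cf] t0 Ut; have [d2f _] := Cf u.
have t00 : 0 \in `[0, t] by rewrite in_itv /= lexx.
have tt0 : t \in `[0, t] by rewrite in_itv /= lexx t0.
have sE s : x + s *: u + t *: v = x + t *: v + s *: u by rewrite addrAC.
have [|s st] := @mean_value_line (fun y => f (y + t *: v) - f y) x u t t0.
  move=> s st; apply: differentiableB.
    apply: differentiable_comp; last by apply: df; exact: Ut.
    by apply: ex_diff.
  by apply: df; have := Ut s 0 st t00; rewrite scale0r addr0.
move=> ->.
have [r rt E] := @mean_value_line ('D_u f) (x + s *: u) v t t0
  (fun r rt => d2f _ (Ut s r st rt)).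
exists (x + s *: u + r *: v); first by exists s, r.
rewrite -E; congr (_ * _).
have d1 : differentiable f (x + s *: u + t *: v) by apply: df; exact: Ut.
have d0 : differentiable f (x + s *: u).
  by apply: df; have := Ut s 0 st t00; rewrite scale0r addr0.
have ds : is_diff (x + s *: u) (shift (t *: v)) id.
  by apply: is_diff_eq; rewrite addr0.
have dft : differentiable (f \o shift (t *: v)) (x + s *: u).
  by apply: differentiable_comp.
rewrite deriveB; [|exact: diff_derivable..].
by congr (_ - _); rewrite (deriveE _ dft) diff_comp // diff_val /= deriveE.
Qed.

(* The second difference of [f] over the parallelogram spanned by [t *: u] and
   [t *: v] is [t ^+ 2] times a value of either mixed derivative nearby. *)
Lemma derive_comm U f u v x : open U -> Ck 2 U f -> U x ->
  'D_u ('D_v f) x = 'D_v ('D_u f) x.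
Proof.
move=> oU Cf Ux; have [_ Cf1] := Cf; have [_ Cuv] := Cf1 v.
have [_ Cvu] := Cf1 u.
apply/eqP; rewrite -subr_eq0 -normr_le0; apply/ler_addgt0Pl => e e0.
rewrite addr0.
have e2 : 0 < e / 2 by rewrite divr_gt0.
have /cvgrPdist_le /(_ _ e2) nuv := Cuv u x Ux.
have /cvgrPdist_le /(_ _ e2) nvu := Cvu v x Ux.
have nU := open_nbhs_nbhs (conj oU Ux).
have /nbhs_ballP [d /= d0 dP] : nbhs x (U `&`
    ([set y | `|'D_u ('D_v f) x - 'D_u ('D_v f) y| <= e / 2] `&`
     [set y | `|'D_v ('D_u f) x - 'D_v ('D_u f) y| <= e / 2])).
  exact: filterI nU (filterI nuv nvu).
(* [m] exceeds [|u| + |v|], so for [t = d / (2 * m)] the whole parallelogram lies in the ball of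
   radius [d]; the summand 1 keeps [m] positive. *)
pose m := 1 + `|u| + `|v|.
have m0 : 0 < m by rewrite /m -addrA ltr_wpDr // addr_ge0.
pose t := d / (2 * m); have t0 : 0 < t by rewrite divr_gt0 // mulr_gt0.
have dt s r : s \in `[0, t] -> r \in `[0, t] ->
    ball x d (x + s *: u + r *: v).
  rewrite !in_itv /= => /andP[s0 st] /andP[r0 rt].
  rewrite -ball_normE /=.
  rewrite -addrA opprD addNKr normrN.
  have le1 : `|s *: u + r *: v| <= t * `|u| + t * `|v|.
    rewrite (le_trans (ler_normD _ _)) // !normrZ !ger0_norm //.
    by rewrite lerD // ler_wpM2r.
  apply: (le_lt_trans le1).
  rewrite -mulrDr /t mulrAC ltr_pdivrMr ?mulr_gt0 // ltr_pM2l // /m.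
  by have := (normr_ge0 u, normr_ge0 v) => -[]; lra.
(* Exchanging [u] and [v] only regroups the four values in the second difference, so the two mixed
   derivatives agree at their respective intermediate points. *)
have eq_quot (a b c e' a1 a2 : R) : a - b - (c - e') = t * (t * a1) ->
    a - c - (b - e') = t * (t * a2) -> a1 = a2.
  have t2 : t * t != 0 by rewrite mulf_neq0 // gt_eqF.
  move=> E1 E2; apply: (mulfI t2).
  rewrite /= -(mulrA t t a1) -(mulrA t t a2) -E1 -E2; ring.
have [|y [s1 [r1 [s1t r1t yE]]] E1] :=
    @second_difference U f u v x t Cf (ltW t0).
  by move=> s r st rt; have [] := dP _ (dt _ _ st rt).
have [|z [s2 [r2 [s2t r2t zE]]] E2] :=
    @second_difference U f v u x t Cf (ltW t0).
  by move=> s r st rt; rewrite addrAC; have [] := dP _ (dt _ _ rt st).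
have [_ [_ yn]] := dP _ (dt _ _ s1t r1t); rewrite /= -yE in yn.
have [_ [zn _]] := dP _ (dt _ _ r2t s2t); rewrite /= addrAC -zE in zn.
rewrite (addrAC x (t *: v)) in E2.
have yz := eq_quot _ _ _ _ _ _ E1 E2.
have near_eq (a b c : R) : `|a - c| <= e / 2 -> `|b - c| <= e / 2 ->
    `|a - b| <= e.
  move=> ac bc; rewrite -(subrKA c) (splitr e) (le_trans (ler_normD _ _)) //.
  by rewrite lerD // distrC.
by rewrite -yz in zn; exact: near_eq zn yn.
Qed.
End ScalarFunctions.

(** * Maps between spaces of row vectors *)

Section RowVectors.
Context {R : realType}.

Lemma linear_rV_differentiable m (W : normedModType R)
    (f : {linear 'rV[R]_m -> W}) x : differentiable f x.
Proof.
have -> : (f : _ -> _) =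
    \sum_(k < m) (fun w : 'rV[R]_m => w 0 k *: f (delta_mx 0 k)).
  apply/funext => w; rewrite fct_sumE [in LHS](row_sum_delta w) linear_sum.
  by apply: eq_bigr => k _; rewrite linearZ.
apply: differentiable_sum => k.
exact/differentiableZl/differentiable_coord.
Qed.

Lemma derive_rV_linear m (V W : normedModType R) (L : {linear 'rV[R]_m -> W})
    (f : V -> 'rV[R]_m) x v : differentiable f x ->
  differentiable (fun y => L (f y)) x /\
  'D_v (fun y => L (f y)) x = L ('D_v f x).
Proof.
move=> df; have dL y := linear_rV_differentiable L y.
have dLf : differentiable (L \o f) x by exact: differentiable_comp.
split=> //; rewrite (deriveE _ dLf) diff_comp //= deriveE //.
by rewrite diff_lin // => y; exact: differentiable_continuous.
Qed.

Lemma derive_coord m (V : normedModType R) (f : V -> 'rV[R]_m) x v k :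
  differentiable f x ->
  differentiable (fun y => f y 0 k) x /\
  'D_v (fun y => f y 0 k) x = ('D_v f x) 0 k.
Proof.
move=> df; split; last by rewrite derive_mx ?mxE //; exact: diff_derivable.
exact: (differentiable_comp df (differentiable_coord (f x) 0 k)).
Qed.

Lemma diff_sum_delta m (W : normedModType R) (f : 'rV[R]_m -> W) x v :
  differentiable f x ->
  'D_v f x = \sum_k v 0 k *: 'D_(delta_mx 0 k) f x.
Proof.
move=> df; rewrite deriveE // [in LHS](row_sum_delta v) linear_sum.
by apply: eq_bigr => k _; rewrite linearZ deriveE.
Qed.

Lemma differentiable_rV m (V : normedModType R) (f : V -> 'rV[R]_m) x :
  (forall k, differentiable (fun y => f y 0 k) x) -> differentiable f x.
Proof.
move=> df.
have -> : f = \sum_k (fun y => f y 0 k *: delta_mx 0 k).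
  by apply/funext => y; rewrite fct_sumE -row_sum_delta.
by apply: differentiable_sum => k; exact: differentiableZl.
Qed.

Section AlongField.
Variables (m : nat) (U : set 'rV[R]_m).
Variables (X : 'rV[R]_m -> 'rV[R]_m) (x : 'rV[R]_m).
Hypotheses (oU : open U) (Ux : U x) (dX : differentiable X x).

Lemma derive_along (f : 'rV[R]_m -> R) v u : 'D_v X x = u ->
  (forall y, U y -> differentiable f y) ->
  (forall w, differentiable ('D_w f) x) ->
  differentiable (fun y => 'D_(X y) f y) x /\
  'D_v (fun y => 'D_(X y) f y) x =
    'D_v ('D_(X x) f) x + 'D_u f x.
Proof.
move=> <- df d2f.
pose h k (y : 'rV[R]_m) : R := X y 0 k * 'D_(delta_mx 0 k) f y.
have dXk k := derive_coord v k dX.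
have dh k : differentiable (h k) x.
  by apply: differentiableM; [case: (dXk k)|exact: d2f].
have hE : \forall y \near x, (\sum_k h k) y = 'D_(X y) f y.
  apply: (open_near_eq oU Ux) => y; rewrite inE => Uy.
  by rewrite fct_sumE diff_sum_delta //; exact: df.
(* The same expansion with the coefficients frozen at [x]. *)
have h2E : \forall y \near x,
    (\sum_k (fun y => X x 0 k * 'D_(delta_mx 0 k) f y)) y = 'D_(X x) f y.
  apply: (open_near_eq oU Ux) => y; rewrite inE => Uy.
  by rewrite fct_sumE diff_sum_delta //; exact: df.
split.
  exact/(near_eq_differentiable hE)/differentiable_sum.
rewrite -(near_eq_derive _ hE) -(near_eq_derive _ h2E).
rewrite derive_sum => [|k]; last exact: diff_derivable.
rewrite derive_sum => [|k]; last first.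
  by apply: diff_derivable; exact: differentiableM.
rewrite (diff_sum_delta _ (df _ Ux)) -big_split /=; apply: eq_bigr => k _.
rewrite deriveM; [|by apply: diff_derivable; case: (dXk k)
  |exact: diff_derivable].
rewrite deriveM; [|exact: derivable_cst|exact: diff_derivable].
rewrite derive_cst scaler0 addr0; case: (dXk k) => _ ->.
by congr (_ + _); exact: mulrC.
Qed.

Lemma differentiable_along l (f : 'rV[R]_m -> 'rV[R]_l) :
  (forall y, U y -> differentiable f y) ->
  (forall w, differentiable ('D_w f) x) ->
  differentiable (fun y => 'd f y (X y)) x.
Proof.
move=> df d2f; apply: differentiable_rV => k.
pose fk y := f y 0 k.
have dfk y v : U y -> 'D_v fk y = ('D_v f y) 0 k.
  by move=> Uy; have [] := derive_coord v k (df _ Uy).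
(* The direction 0 is arbitrary: only the differentiability half is wanted. *)
have [|w|d _] := @derive_along fk 0 _ erefl.
- by move=> y Uy; have [] := derive_coord 0 k (df _ Uy).
- have [+ _] := derive_coord 0 k (d2f w); apply: near_eq_differentiable.
  by apply: (open_near_eq oU Ux) => y; rewrite inE => Uy; rewrite dfk.
apply: near_eq_differentiable d; apply: (open_near_eq oU Ux) => y.
by rewrite inE => Uy; rewrite dfk // deriveE //; exact: df.
Qed.

End AlongField.

End RowVectors.

(** * Rules for explicit derivatives and smoothness *)

Section Derivatives.
Context {R : realType} {V : normedModType R}.
Implicit Types (f g : V -> R) (x v : V).

Lemma is_derive_mul f g x v df dg : is_derive x v f df -> is_derive x v g dg ->
  is_derive x v (fun y => f y * g y) (df * g x + f x * dg).
Proof.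
move=> hf hg; apply: (is_derive_eq (is_deriveM hf hg)).
by rewrite addrC -[_ *: df]/(_ * df) mulrC.
Qed.

Lemma is_derive_sub f g x v df dg : is_derive x v f df -> is_derive x v g dg ->
  is_derive x v (fun y => f y - g y) (df - dg).
Proof. by move=> hf hg; exact: (is_deriveB hf hg). Qed.

Lemma is_derive_sqr f x v df : is_derive x v f df ->
  is_derive x v (fun y => f y ^+ 2) (2 * f x * df).
Proof.
move=> hf; apply: (is_derive_eq (is_derive_mul hf hf)); ring.
Qed.

Lemma is_derive_inv f x v df : f x != 0 -> is_derive x v f df ->
  is_derive x v (fun y => (f y)^-1) (- (f x) ^- 2 * df).
Proof.
move=> fx [hf <-]; apply: DeriveDef; first exact: derivableV.
by rewrite deriveV.
Qed.

Lemma smooth_sum U m (f : 'I_m -> V -> R) : open U ->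
  (forall k, smooth_on U (f k)) -> smooth_on U (fun x => \sum_k f k x).
Proof.
move=> oU; elim: m f => [|m IHm] f sf k.
  have -> : (fun x => \sum_(i < 0) f i x) = (fun=> 0 : R).
    by apply/funext => x; rewrite big_ord0.
  exact: Ck_cst.
have -> : (fun x => \sum_i f i x) =
    (fun x => f ord0 x + \sum_i f (lift ord0 i) x).
  by apply/funext => x; rewrite big_ord_recl.
by apply: CkD => //; [exact: sf|exact: IHm].
Qed.

Lemma smooth_coord U m (f : V -> 'rV[R]_m) k : open U -> smooth_on U f ->
  smooth_on U (fun x => f x 0 k).
Proof.
move=> oU sf j; elim: j f sf => [|j IHj] f sf.
  move=> x Ux; have [d _] := derive_coord 0 k (smooth_differentiable sf Ux).
  exact: differentiable_continuous.
split=> [x Ux|v].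
  by have [] := derive_coord 0 k (smooth_differentiable sf Ux).
apply: Ck_eq (IHj _ (smooth_derive v sf)) => // x; rewrite inE => Ux.
by have [_ ->] := derive_coord v k (smooth_differentiable sf Ux).
Qed.

End Derivatives.

(** * The tangent bundle in a natural chart *)

Section ChartGeometry.
Context {R : realType} {n : nat}.
Local Notation pt := 'rV[R]_(n + n).
Local Notation vec := 'rV[R]_(n + n).
Local Notation pivec := 'rV[R]_n.
(* [HB.structures] also exports an [eta]. *)
Local Notation eta := Defs.eta.
Implicit Types (p q : pt) (a b w z : pivec) (v : vec).

Definition hor a : vec := row_mx a 0.

(** As a matrix product, [gam] becomes visibly linear, hence commutes with derivatives. *)
Lemma gamE a : gam a = a *m (row_mx 0 1%:M : 'M[R]_(n, n + n)).
Proof. by rewrite mul_mx_row mulmx0 mulmx1. Qed.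

Lemma horE a : hor a = a *m (row_mx 1%:M 0 : 'M[R]_(n, n + n)).
Proof. by rewrite mul_mx_row mulmx0 mulmx1. Qed.

Lemma gam0 : gam (0 : pivec) = 0.
Proof. by rewrite gamE mul0mx. Qed.

Lemma rho_gam a : rho (gam a) = 0.
Proof. exact: row_mxKl. Qed.

Lemma rho_hor a : rho (hor a) = a.
Proof. exact: row_mxKl. Qed.

Lemma eta_gam a : eta (gam a : pt) = a.
Proof. exact: row_mxKr. Qed.

Lemma eta_hor a : eta (hor a : pt) = 0.
Proof. exact: row_mxKr. Qed.

Lemma Jv_hor a : Jv (hor a) = gam a.
Proof. by rewrite /Jv rho_hor. Qed.

Lemma Jv_gam a : Jv (gam a) = 0.
Proof. by rewrite /Jv rho_gam gam0. Qed.

Lemma hor_gam v : v = hor (rho v) + gam (eta v).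
Proof. by rewrite /hor /gam add_row_mx addr0 add0r hsubmxK. Qed.

Lemma derive_gam (f : pt -> pivec) p v : differentiable f p ->
  differentiable (gam \o f) p /\ 'D_v (gam \o f) p = gam ('D_v f p).
Proof.
move=> df; pose A : 'M[R]_(n, n + n) := row_mx 0 1%:M.
have [d E] := derive_rV_linear (mulmxr A) v df.
have -> : gam \o f = fun q => f q *m A.
  by apply/funext => q; exact: gamE.
by rewrite gamE.
Qed.

Lemma derive_hor (f : pt -> pivec) p v : differentiable f p ->
  differentiable (hor \o f) p /\ 'D_v (hor \o f) p = hor ('D_v f p).
Proof.
move=> df; pose A : 'M[R]_(n, n + n) := row_mx 1%:M 0.
have [d E] := derive_rV_linear (mulmxr A) v df.
have -> : hor \o f = fun q => f q *m A.
  by apply/funext => q; exact: horE.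
by rewrite horE.
Qed.

Lemma derive_rho (X : pt -> vec) p v : differentiable X p ->
  differentiable (rho \o X) p /\ 'D_v (rho \o X) p = rho ('D_v X p).
Proof. exact: (derive_rV_linear lsubmx). Qed.

Lemma derive_eta p v : differentiable eta p /\ 'D_v eta p = eta v.
Proof.
have did : differentiable (id : pt -> pt) p by exact: ex_diff.
have [d E] := derive_rV_linear rsubmx v did.
by split=> //; rewrite [LHS]E derive_id.
Qed.

(** * The vertical Hessian and Euler's identity *)

Section Euler.
Variables (U : set pt) (E : pt -> R).
Hypotheses (oU : open U) (sE : smooth_on U E).

Lemma derive2C q u v : U q -> 'D_u ('D_v E) q = 'D_v ('D_u E) q.
Proof. exact: derive_comm. Qed.

Lemma smooth_diff q : U q -> differentiable E q.
Proof. exact: smooth_differentiable. Qed.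

Lemma smooth_diff_derive q v : U q -> differentiable ('D_v E) q.
Proof. exact/smooth_differentiable/smooth_derive. Qed.

Lemma deriveDr q u v : U q -> 'D_(u + v) E q = 'D_u E q + 'D_v E q.
Proof. by move=> /smooth_diff dE; rewrite !deriveE // linearD. Qed.

Lemma ddJE q u v : U q ->
  ddJ E q u v = 'D_u ('D_(Jv v) E) q - 'D_v ('D_(Jv u) E) q.
Proof.
have dJE v1 v2 : U q -> 'd (fun q => dJ E q v1) q v2 = 'D_v2 ('D_(Jv v1) E) q.
  (* [dJ] is defined by the differential, which is the directional derivative only where [E] is
     differentiable; openness of [U] gives this near [q]. *)
  move=> Uq; have nE : \forall y \near q, dJ E y v1 = 'D_(Jv v1) E y.
    apply: (open_near_eq oU Uq) => y; rewrite inE => Uy.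
    by rewrite /dJ deriveE //; exact: smooth_diff.
  have dE := smooth_diff_derive (Jv v1) Uq.
  rewrite -(near_eq_derive _ nE) deriveE //.
  by apply: near_eq_differentiable dE; near do apply/esym.
by move=> Uq; rewrite /ddJ /dext !dJE.
Unshelve. all: by end_near. Qed.

(** Since J kills vertical vectors, the second term of [ddJE] drops out, and the metric is the
    Hessian of [E] in the fibre directions. *)
Lemma metricE q a b : U q -> metric E q a b = 'D_(gam a) ('D_(gam b) E) q.
Proof.
move=> Uq; rewrite /metric -/(hor a) -/(hor b) Jv_hor ddJE // Jv_hor Jv_gam.
have -> : 'D_0 E = (fun=> 0) by apply/funext => x; rewrite derive0.
by rewrite derive_cst subr0.
Qed.

Lemma metricC q a b : U q -> metric E q a b = metric E q b a.
Proof.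
move=> Uq.
rewrite (metricE a b Uq).
rewrite (metricE b a Uq).
exact: derive2C.
Qed.

(** Adding [(t - 1)] times the Liouville vector multiplies y by [t] and fixes x, so this is
    homogeneity of degree 2 in y. *)
Hypothesis hom : forall q t, U q -> 0 < t ->
  E (q + (t - 1) *: Liouville q) = t ^+ 2 * E q.

(** Homogeneity is differentiated at scale 1. The scale is written [1 + t], which is positive for
    [t] near 0. *)
Lemma euler q : U q -> 'D_(Liouville q) E q = 2 * E q.
Proof.
move=> Uq; set L := Liouville q.
have dq : differentiable E (q + 0 *: L).
  by rewrite scale0r addr0; exact: smooth_diff.
have [_ +] := is_derive_line dq; rewrite scale0r addr0 => <-.
have hE : \forall t \near (0 : R), (1 + t) ^+ 2 * E q = E (q + t *: L).
  have t1 : \forall t \near (0 : R), -1 < t.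
    by apply: lt_nbhsr; rewrite oppr_lt0.
  near=> t; rewrite -hom //; first by rewrite [1 + t]addrC addrK.
  by rewrite -ltrBlDl sub0r; near: t.
have d1 : is_derive (0 : R) 1 (fun t => 1 + t) 1.
  by apply: is_derive_eq; rewrite add0r.
have d2 := is_derive_mul (is_derive_sqr d1) (is_derive_cst (E q) (0 : R) 1).
rewrite -(near_eq_derive _ hE); have [_ ->] := d2; rewrite /cst; ring.
Unshelve. all: by end_near. Qed.

(** Euler's identity is differentiated along [v]. The left-hand derivative is taken with the
    Liouville vector frozen at [q]; the variation of the Liouville field accounts for the subtracted
    term. *)
Lemma euler_derive q v : U q ->
  'D_v ('D_(gam (eta q)) E) q = 2 * 'D_v E q - 'D_(gam (eta v)) E q.
Proof.
move=> Uq; have [de Ee] := derive_eta q v.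
have [dg Eg] := derive_gam v de.
have EX : 'D_v (gam \o eta) q = gam (eta v) by rewrite Eg Ee.
have [||_ E2] := derive_along oU Uq dg (f := E) EX.
- by move=> y Uy; exact: smooth_diff.
- by move=> w; exact: smooth_diff_derive.
apply/eqP; rewrite eq_sym subr_eq -E2; apply/eqP.
have hE : \forall y \near q, 2 * E y = 'D_((gam \o eta) y) E y.
  by apply: (open_near_eq oU Uq) => y; rewrite inE => Uy; rewrite -euler.
rewrite -(near_eq_derive _ hE).
have [_ e] := is_derive_mul (is_derive_cst (2 : R) q v)
  (derivableP (@diff_derivable _ _ _ E q v (smooth_diff Uq))).
by rewrite [RHS]e /cst mul0r add0r.
Qed.

Lemma metric_eta q a : U q -> metric E q a (eta q) = 'D_(gam a) E q.
Proof.
by move=> Uq; rewrite metricE // euler_derive // eta_gam; ring.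
Qed.

Lemma metric0l q b : U q -> metric E q 0 b = 0.
Proof. by move=> Uq; rewrite metricE // gam0 derive0. Qed.

Lemma metric0r q a : U q -> metric E q a 0 = 0.
Proof. by move=> Uq; rewrite metricC // metric0l. Qed.

Lemma metricNl q a b : U q -> metric E q (- a) b = - metric E q a b.
Proof.
move=> Uq; rewrite (metricE (- a) b Uq) (metricE a b Uq).
rewrite !(deriveE _ (smooth_diff_derive _ Uq)).
by rewrite !gamE mulNmx linearN.
Qed.

Lemma metricNr q a b : U q -> metric E q a (- b) = - metric E q a b.
Proof. by move=> Uq; rewrite (metricC a) // metricNl // (metricC b). Qed.

(** Both arguments of the metric stay frozen at [eta q]; only the base point moves. The function [f]
    is homogeneous of degree 1 in y, and differentiating its Euler identity along [v] expresses the
    Hessian through first derivatives of [E]. The vertical part of [v] cancels: the Cartan tensor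
    vanishes on the direction y. *)
Lemma derive_metric_eta q v : U q ->
  'D_v (fun y => metric E y (eta q) (eta q)) q = 2 * 'D_(hor (rho v)) E q.
Proof.
move=> Uq; have [de Ee] := derive_eta q v.
have [dg Eg] := derive_gam v de; pose f := 'D_(gam (eta q)) E.
have sf : smooth_on U f := smooth_derive _ sE.
have EX : 'D_v (gam \o eta) q = gam (eta v) by rewrite Eg Ee.
have [||_ E2] := derive_along oU Uq dg (f := f) EX.
- by move=> y Uy; exact: smooth_differentiable sf Uy.
- by move=> w; exact: smooth_differentiable (smooth_derive w sf) Uq.
have h1 : \forall y \near q, 'D_((gam \o eta) y) f y = f y.
  apply: (open_near_eq oU Uq) => y; rewrite inE => Uy.
  rewrite /f (derive2C _ _ Uy) (euler_derive (gam (eta q)) Uy) eta_gam; ring.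
have h2 : \forall y \near q,
    metric E y (eta q) (eta q) = 'D_(gam (eta q)) f y.
  by apply: (open_near_eq oU Uq) => y; rewrite inE => Uy; rewrite metricE.
have {}E2 := etrans (esym (near_eq_derive v h1)) E2.
have e1 : 'D_v f q = 2 * 'D_v E q - 'D_(gam (eta v)) E q := euler_derive v Uq.
have e2 : 'D_(gam (eta v)) f q = 'D_(gam (eta v)) E q.
  by rewrite (euler_derive (gam (eta v)) Uq) eta_gam; ring.
have e3 : 'D_v E q = 'D_(hor (rho v)) E q + 'D_(gam (eta v)) E q.
  by rewrite -(deriveDr _ _ Uq) -hor_gam.
rewrite e1 e2 e3 in E2; apply: (etrans (near_eq_derive v h2)).
apply: (addIr ('D_(gam (eta v)) E q)); apply: (etrans (esym E2)); ring.
Qed.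

End Euler.
End ChartGeometry.

(** * Brackets and the horizontal lift *)

Section Connection.
Context {R : realType} {n : nat}.
Local Notation pt := 'rV[R]_(n + n).
Local Notation vec := 'rV[R]_(n + n).
Local Notation pivec := 'rV[R]_n.
Local Notation eta := Defs.eta.
Variables (U : set pt) (G : pt -> vec).
Hypotheses (oU : open U) (sG : smooth_on U G).
Hypothesis rhoG : forall q, U q -> rho (G q) = eta q.

Lemma rhoB (u v : vec) : rho (u - v) = rho u - rho v.
Proof. by rewrite /rho linearB. Qed.

Lemma rhoD (u v : vec) : rho (u + v) = rho u + rho v.
Proof. by rewrite /rho linearD. Qed.

Lemma rhoZ (c : R) (u : vec) : rho (c *: u) = c *: rho u.
Proof. by rewrite /rho linearZ. Qed.

(** As [rho] is linear, it commutes with the derivatives in the bracket, so only the x-components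
    [A] and [B] need to be differentiated. *)
Lemma rho_lie (X Y : pt -> vec) (A B : pt -> pivec) p : U p ->
  differentiable X p -> differentiable Y p ->
  (forall q, U q -> rho (X q) = A q) -> (forall q, U q -> rho (Y q) = B q) ->
  rho (lie X Y p) = 'D_(X p) B p - 'D_(Y p) A p.
Proof.
move=> Up dX dY XA YB.
have rho_diff (Z : pt -> vec) C v : differentiable Z p ->
    (forall q, U q -> rho (Z q) = C q) -> rho ('d Z p v) = 'D_v C p.
  move=> dZ ZC; rewrite -(deriveE v dZ).
  apply: (etrans (esym (derive_rho v dZ).2)); apply: near_eq_derive.
  by apply: (open_near_eq oU Up) => q; rewrite inE; exact: ZC.
by rewrite /lie rhoB (rho_diff _ _ _ dX XA) (rho_diff _ _ _ dY YB).
Qed.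

Lemma Jv_hor_comp (W : pt -> pivec) :
  Jv \o (fun p => row_mx (W p) 0) = gam \o W.
Proof. by apply/funext => q /=; exact: Jv_hor. Qed.

(** With [rho G = eta], the bracket [JW, G] projects to [W], while the other term of the Barthel
    connection is vertical; the half in the projector then averages [W] with itself. *)
Lemma rho_beta (W : pt -> pivec) q : differentiable W q -> U q ->
  rho (beta G W q) = W q.
Proof.
move=> dW Uq; rewrite /beta /hproj /Barthel Jv_hor_comp.
have [dg _] := derive_gam 0 dW; have dG := smooth_differentiable sG Uq.
rewrite rhoZ rhoD rhoB [rho (row_mx _ _)]rho_hor.
have -> : rho (Jv (lie (fun p => row_mx (W p) 0) G q)) = 0 by exact: rho_gam.
have -> : rho (lie (gam \o W) G q) = W q.
  rewrite (rho_lie Uq dg dG (fun y _ => rho_gam (W y)) rhoG) derive_cst subr0.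
  by rewrite (derive_eta q _).2; exact: eta_gam.
by rewrite subr0 -[W q]scale1r -scalerDl scalerA mulVf // pnatr_eq0.
Qed.

Lemma smooth_gam (W : pt -> pivec) : smooth_on U W -> smooth_on U (gam \o W).
Proof.
move=> sW k; elim: k W sW => [|k IHk] W sW.
  move=> q Uq; have [d _] := derive_gam 0 (smooth_differentiable sW Uq).
  exact: differentiable_continuous.
split=> [q Uq|v];
  first by have [] := derive_gam 0 (smooth_differentiable sW Uq).
apply: Ck_eq (IHk _ (smooth_derive v sW)) => // q; rewrite inE => Uq.
by have [_ ->] := derive_gam v (smooth_differentiable sW Uq).
Qed.

Lemma smooth_hor (W : pt -> pivec) : smooth_on U W -> smooth_on U (hor \o W).
Proof.
move=> sW k; elim: k W sW => [|k IHk] W sW.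
  move=> q Uq; have [d _] := derive_hor 0 (smooth_differentiable sW Uq).
  exact: differentiable_continuous.
split=> [q Uq|v];
  first by have [] := derive_hor 0 (smooth_differentiable sW Uq).
apply: Ck_eq (IHk _ (smooth_derive v sW)) => // q; rewrite inE => Uq.
by have [_ ->] := derive_hor v (smooth_differentiable sW Uq).
Qed.

Lemma differentiable_lie (X Y : pt -> vec) q : smooth_on U X -> smooth_on U Y ->
  U q -> differentiable (lie X Y) q.
Proof.
move=> sX sY Uq; apply: differentiableB; apply: (differentiable_along oU Uq).
- exact: smooth_differentiable sX Uq.
- by move=> y; exact: smooth_differentiable.
- by move=> w; exact: smooth_differentiable (smooth_derive w sY) Uq.
- exact: smooth_differentiable sY Uq.
- by move=> y; exact: smooth_differentiable.
- by move=> w; exact: smooth_differentiable (smooth_derive w sX) Uq.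
Qed.

Lemma differentiable_beta (W : pt -> pivec) q : smooth_on U W -> U q ->
  differentiable (beta G W) q.
Proof.
move=> sW Uq; have sh := smooth_hor sW.
rewrite /beta /hproj /Barthel Jv_hor_comp; apply: differentiableZ.
apply: differentiableD; first exact: smooth_differentiable sh Uq.
apply: differentiableB; first exact: differentiable_lie (smooth_gam sW) sG Uq.
have [dr _] := derive_rho 0 (differentiable_lie sh sG Uq).
by have [] := derive_gam 0 dr.
Qed.

End Connection.
(** * Concurrent fields *)

Section ConcurrentField.
Context {R : realType} {n : nat}.
Local Notation pt := 'rV[R]_(n + n).
Local Notation vec := 'rV[R]_(n + n).
Local Notation pivec := 'rV[R]_n.
Local Notation eta := Defs.eta.

Lemma diff_horizontal (W : normedModType R) (f : pt -> W) q v :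
  differentiable f q -> (forall w : pivec, 'D_(gam w) f q = 0) ->
  'd f q v = 'D_(hor (rho v)) f q.
Proof.
move=> df f0; rewrite {1}(hor_gam v) linearD -(deriveE (hor _) df).
by rewrite -(deriveE (gam _) df) f0 addr0.
Qed.

(** In the application [U1] is the chart image of the slit bundle, where the concurrency equations
    are posed, and [U] is that of the conic domain. The equations are tested on [phi] and constant
    fields, smooth on [U1], at points of [U]. *)
Variables (U U1 : set pt) (E : pt -> R) (G : pt -> vec) (phi : pt -> pivec).
Hypotheses (oU : open U) (sUU1 : U `<=` U1).
Hypotheses (sE : smooth_on U E) (sG : smooth_on U G) (sphi : smooth_on U1 phi).
Hypothesis hom : forall q t, U q -> 0 < t ->
  E (q + (t - 1) *: Liouville q) = t ^+ 2 * E q.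
Hypothesis JG : forall q, U q -> Jv (G q) = Liouville q.
Hypothesis sprayG : forall q a, U q -> ddJ E q (G q) a = - 'd E q a.
Hypothesis conc : concurrent_on G U1 E phi.

Let sphiU : smooth_on U phi := smooth_subset sUU1 sphi.

Lemma rho_spray q : U q -> rho (G q) = eta q.
Proof. by move=> /JG /(congr1 eta); rewrite /Jv !eta_gam. Qed.

Lemma differentiable_phi q : U q -> differentiable phi q.
Proof. exact: smooth_differentiable. Qed.

(** For the constant field [w], the vertical Berwald derivative of [phi] is [rho] of
    [gam w, beta phi], that is, the derivative of [phi] along [gam w]. *)
Lemma derive_phi_ver q (w : pivec) : U q -> 'D_(gam w) phi q = 0.
Proof.
move=> Uq; have [nh [nv [_ H]]] := conc.
have [_ _ _] := H (fun=> w) (smooth_cst U1 w) q (sUU1 Uq); rewrite /Berwald_ver.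
have dg : differentiable (gam \o (fun _ : pt => w)) q.
  exact: differentiable_cst.
have db := differentiable_beta oU sG sphiU Uq.
rewrite (rho_lie oU Uq dg db (fun y _ => rho_gam w) (B := phi)).
  by rewrite derive_cst subr0.
by move=> y Uy; exact: (rho_beta oU sG rho_spray (differentiable_phi Uy) Uy).
Qed.

Lemma diff_phi q v : U q -> 'd phi q v = 'D_(hor (rho v)) phi q.
Proof.
move=> Uq; apply: diff_horizontal; first exact: differentiable_phi.
by move=> w; exact: derive_phi_ver.
Qed.

Lemma near_metric (X Y : pt -> pivec) q : U q -> \forall y \near q,
  'D_(gam (X y)) ('D_(gam (Y y)) E) y = metric E y (X y) (Y y).
Proof.
move=> Uq; apply: (open_near_eq oU Uq) => y; rewrite inE => Uy.
by rewrite (metricE oU sE _ _ Uy).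
Qed.

Lemma differentiable_metric (X : pt -> pivec) (z : pivec) q : smooth_on U X ->
  U q -> differentiable (fun y => metric E y (X y) z) q.
Proof.
move=> sX Uq; have dX := smooth_differentiable (smooth_gam oU sX) Uq.
have sz := smooth_derive (gam z) sE.
have [||d _] := derive_along oU Uq dX (f := 'D_(gam z) E) (erefl ('D_0 _ q)).
- by move=> y; exact: smooth_differentiable.
- by move=> w; exact: smooth_differentiable (smooth_derive w sz) Uq.
exact: near_eq_differentiable (near_metric X (fun=> z) Uq) d.
Qed.

(** In the vertical Cartan equation for constant [w] and [z] the left side vanishes by concurrency.
    So do both bracket terms: one because [z] and [w] are constant, the other by the vertical
    Berwald equation. *)
Lemma derive_metric_phi_ver q (w z : pivec) : U q ->
  'D_(gam w) (fun y => metric E y (phi y) z) q = 0.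
Proof.
move=> Uq; have [nh [nv [C H]]] := conc.
have [_ _ nv0 bv0] := H (fun=> w) (smooth_cst U1 w) q (sUU1 Uq).
have [+ _] := C (fun=> w) phi (fun=> z) (smooth_cst U1 w) sphi
  (smooth_cst U1 z) q (sUU1 Uq).
rewrite nv0 (metric0l oU sE _ Uq) mulr0.
have dg : differentiable (gam \o (fun _ : pt => w)) q.
  exact: differentiable_cst.
have db := differentiable_beta oU sG (smooth_cst U z) Uq.
have -> : rho (lie (beta G (fun=> z)) (gam \o (fun=> w)) q) = 0.
  rewrite (rho_lie oU Uq db dg (A := fun=> z) (B := fun=> 0)).
  - by rewrite !derive_cst subr0.
  - move=> y Uy.
    exact: (rho_beta oU sG rho_spray (differentiable_cst _ _) Uy).
  - by move=> y _; exact: rho_gam.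
rewrite [rho (lie _ _ _)]bv0 !(metric0r oU sE _ Uq) !addr0.
by move=> ->; exact: (deriveE (gam w) (differentiable_metric z sphiU Uq)).
Qed.

Lemma diff_metric_phi q (z : pivec) v : U q ->
  'd (fun y => metric E y (phi y) z) q v =
  'D_(hor (rho v)) (fun y => metric E y (phi y) z) q.
Proof.
move=> Uq; apply: diff_horizontal; first exact: differentiable_metric.
by move=> w; exact: derive_metric_phi_ver.
Qed.

(** This is the horizontal Cartan equation for constant [w] and [z]. As [phi] and g(phi, -) do not
    depend on y, horizontal lifts may be replaced by [hor], except in the derivative of g(z, w)
    along [beta phi]. *)
Lemma Cartan_phi q (w z : pivec) : U q ->
  - (2 * metric E q w z) =
    'D_(hor w) (fun y => metric E y (phi y) z) q
    + 'D_(beta G phi q) (fun y => metric E y z w) q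
    - 'D_(hor z) (fun y => metric E y (phi y) w) q
    + metric E q w ('D_(hor z) phi q) + metric E q z ('D_(hor w) phi q).
Proof.
move=> Uq; have [nh [nv [C H]]] := conc.
have [nhE _ _ _] := H (fun=> w) (smooth_cst U1 w) q (sUU1 Uq).
have [_] := C (fun=> w) phi (fun=> z) (smooth_cst U1 w) sphi
  (smooth_cst U1 z) q (sUU1 Uq).
rewrite nhE => {}C.
have {C} CE : 2 * metric E q (- w) z =
    'd (fun y => metric E y (phi y) z) q (beta G (fun=> w) q)
    + 'd (fun y => metric E y z w) q (beta G phi q)
    - 'd (fun y => metric E y w (phi y)) q (beta G (fun=> z) q)
    - metric E q w (rho (lie (beta G phi) (beta G (fun=> z)) q))
    + metric E q (phi q) (rho (lie (beta G (fun=> z)) (beta G (fun=> w)) q))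
    + metric E q z (rho (lie (beta G (fun=> w)) (beta G phi) q)) := C.
have {}CE := etrans (esym (congr1 ( *%R 2) (metricNl oU sE _ _ Uq))) CE.
rewrite mulrN in CE.
have rb (X : pt -> pivec) : smooth_on U X ->
    forall y, U y -> rho (beta G X y) = X y.
  move=> sX y Uy.
  exact: (rho_beta oU sG rho_spray (smooth_differentiable sX Uy) Uy).
have rl (X Y : pt -> pivec) : smooth_on U X -> smooth_on U Y ->
    rho (lie (beta G X) (beta G Y) q) =
    'D_(beta G X q) Y q - 'D_(beta G Y q) X q.
  move=> sX sY; have dX := differentiable_beta oU sG sX Uq.
  have dY := differentiable_beta oU sG sY Uq.
  exact: (rho_lie oU Uq dX dY (rb _ sX) (rb _ sY)).
have Dphi (X : pt -> pivec) : smooth_on U X ->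
    'D_(beta G X q) phi q = 'D_(hor (X q)) phi q.
  move=> sX; apply: (etrans (deriveE _ (differentiable_phi Uq))).
  by apply: (etrans (diff_phi _ Uq)); rewrite (rb _ sX _ Uq).
have sw := smooth_cst U w; have sz := smooth_cst U z.
have D0 (c : pivec) (v : vec) : 'D_v (fun _ : pt => c) q = 0.
  exact: derive_cst.
have bphiz : rho (lie (beta G phi) (beta G (fun=> z)) q) = - 'D_(hor z) phi q.
  by rewrite (rl _ _ sphiU sz) D0 (Dphi _ sz) sub0r.
have bzw : rho (lie (beta G (fun=> z)) (beta G (fun=> w)) q) = 0.
  by rewrite (rl _ _ sz sw) D0 D0 subr0.
have bwphi : rho (lie (beta G (fun=> w)) (beta G phi) q) = 'D_(hor w) phi q.
  by rewrite (rl _ _ sw sphiU) D0 (Dphi _ sw) subr0.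
have eq_terms (a1 a2 a3 m1 m2 m3 b1 b2 b3 n1 n3 : R) :
    a1 = b1 -> a2 = b2 -> a3 = b3 -> m1 = - n1 -> m2 = 0 -> m3 = n3 ->
    a1 + a2 - a3 - m1 + m2 + m3 = b1 + b2 - b3 + n1 + n3.
  by move=> -> -> -> -> -> ->; ring.
apply: (etrans CE); apply: eq_terms; clear CE.
- by apply: (etrans (diff_metric_phi _ _ Uq)); rewrite (rb _ sw _ Uq).
- exact: (esym (deriveE _ (differentiable_metric w sz Uq))).
- have nC : \forall y \near q, metric E y (phi y) w = metric E y w (phi y).
    apply: (open_near_eq oU Uq) => y; rewrite inE => Uy.
    exact: (metricC oU sE).
  have dw := differentiable_metric w sphiU Uq.
  apply: (etrans (esym (deriveE _ (near_eq_differentiable nC dw)))).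
  apply: (etrans (esym (near_eq_derive _ nC))); apply: (etrans (deriveE _ dw)).
  by apply: (etrans (diff_metric_phi _ _ Uq)); rewrite (rb _ sz q Uq).
- rewrite bphiz.
  exact: (metricNr oU sE w ('D_(hor z) phi q) Uq).
- rewrite bzw.
  exact: (metric0r oU sE _ Uq).
- by rewrite bwphi.
Qed.

(** Exchanging [w] and [z] in [Cartan_phi] swaps the two derivatives of g(phi, -) and preserves the
    sum of all other terms; the difference of the two equations leaves closedness. *)
Lemma metric_phi_closed q (w z : pivec) : U q ->
  'D_(hor w) (fun y => metric E y (phi y) z) q =
  'D_(hor z) (fun y => metric E y (phi y) w) q.
Proof.
have cancel (x x' a b c c' d e : R) : - (2 * x) = a + c - b + d + e ->
    - (2 * x') = b + c' - a + e + d -> x = x' -> c = c' -> a = b.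
  by move=> E1 E2 xx cc; rewrite -xx -cc in E2; lra.
move=> Uq; apply: cancel (Cartan_phi w z Uq) (Cartan_phi z w Uq) _ _.
  exact: (metricC oU sE).
apply: near_eq_derive; apply: (open_near_eq oU Uq) => y; rewrite inE => Uy.
exact: (metricC oU sE).
Qed.

(** In the diagonal case of [Cartan_phi] at [eta q] the derivatives of g(phi, -) cancel. By
    homogeneity g(eta, eta) = 2E, and the remaining metric terms become first derivatives of [E]. *)
Lemma derive_concurrent_energy q : U q ->
  'D_(hor (phi q)) E q + 'D_(gam ('D_(hor (eta q)) phi q)) E q = - (2 * E q).
Proof.
have halve (x a c d e h k : R) : - (2 * x) = a + c - a + d + d -> x = e ->
    c = 2 * h -> d = k -> h + k = - e.
  by move=> E1 xe ch dk; rewrite xe ch dk in E1; lra.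
move=> Uq; have CE := Cartan_phi (eta q) (eta q) Uq.
apply: (halve _ _ _ _ _ _ _ CE).
- apply: (etrans (metric_eta oU sE hom _ Uq)).
  exact: (euler sE hom Uq).
- have rb := rho_beta oU sG rho_spray (differentiable_phi Uq) Uq.
  have := derive_metric_eta oU sE hom (beta G phi q) Uq.
  by rewrite rb.
- apply: (etrans (metricC oU sE _ _ Uq)).
  exact: (metric_eta oU sE hom _ Uq).
Qed.

(* This is [Phi = g(phi, eta)], by [pairing_eta]. *)
Definition pairing q := 'D_(gam (phi q)) E q.

(** In coordinates the pairing is the sum of the components of [phi] times the y-derivatives of
    [E]. *)
Lemma smooth_pairing : smooth_on U pairing.
Proof.
have dE (k : 'I_n) := smooth_derive (gam (delta_mx 0 k)) sE.
have sk (k : 'I_n) : smooth_on U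
    (fun q => phi q 0 k * 'D_(gam (delta_mx 0 k)) E q).
  by move=> j; apply: CkM => //; [exact: smooth_coord|exact: dE].
move=> j; apply: Ck_eq (smooth_sum oU sk j) => // q; rewrite inE => Uq.
rewrite /pairing (deriveE _ (smooth_diff sE Uq)) gamE.
rewrite [phi q in RHS]row_sum_delta.
rewrite mulmx_suml linear_sum; apply: eq_bigr => k _.
rewrite -scalemxAl linearZ -gamE; congr (_ * _).
exact: deriveE _ (smooth_diff sE Uq).
Qed.

Lemma derive_pairing q v : U q ->
  'D_v pairing q =
  'D_v ('D_(gam (phi q)) E) q + 'D_(gam ('D_(hor (rho v)) phi q)) E q.
Proof.
move=> Uq; have [dg Eg] := derive_gam v (differentiable_phi Uq).
have {}Eg : 'D_v (gam \o phi) q = gam ('D_(hor (rho v)) phi q).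
  apply: (etrans Eg); congr gam.
  exact: etrans (deriveE _ (differentiable_phi Uq)) (diff_phi _ Uq).
have [||_ ->] := derive_along oU Uq dg (f := E) Eg => //.
- by move=> y; exact: smooth_diff.
- by move=> w; exact: smooth_diff_derive.
Qed.

Lemma derive_pairing_ver q (w : pivec) : U q ->
  'D_(gam w) pairing q = metric E q (phi q) w.
Proof.
move=> Uq; apply: (etrans (derive_pairing _ Uq)).
rewrite rho_gam; have -> : hor (0 : pivec) = 0 by exact: row_mx0.
rewrite derive0 gam0 derive0 addr0.
by rewrite -(metricE oU sE _ _ Uq) (metricC oU sE).
Qed.

Lemma pairing_eta q : U q -> pairing q = metric E q (phi q) (eta q).
Proof. by move=> Uq; rewrite (metric_eta oU sE hom). Qed.

(** The spray equation is evaluated on [hor b]. Since JG is the Liouville field, its second term is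
    twice the derivative of [E] along [hor b] by Euler's identity. *)
Lemma spray_derive q (b : pivec) : U q ->
  'D_(G q) ('D_(gam b) E) q = 'D_(hor b) E q.
Proof.
move=> Uq; have := sprayG (hor b) Uq; rewrite (ddJE oU sE _ _ Uq) Jv_hor JG //.
have e1 := euler_derive oU sE hom (hor b) Uq.
rewrite eta_hor gam0 derive0 subr0 in e1.
rewrite -(deriveE _ (smooth_diff sE Uq)).
have alg (x y z : R) : y = 2 * z -> x - y = - z -> x = z by lra.
by move=> e2; exact: alg e1 e2.
Qed.

(** The 2-form vanishes on the pair (G, G). *)
Lemma spray_energy q : U q -> 'D_(G q) E q = 0.
Proof.
move=> Uq; have := sprayG (G q) Uq; rewrite (ddJE oU sE _ _ Uq) subrr.
move=> /esym/eqP; rewrite oppr_eq0 => /eqP e.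
exact: etrans (deriveE _ (smooth_diff sE Uq)) e.
Qed.

(** Differentiating D_(gam phi) E along [G] gives one term from Euler-Lagrange and one from the
    variation of [phi]; [derive_concurrent_energy] evaluates their sum. *)
Lemma spray_pairing q : U q -> 'D_(G q) pairing q = - (2 * E q).
Proof.
move=> Uq; apply: (etrans (derive_pairing _ Uq)).
rewrite (rho_spray Uq).
exact: etrans (congr1 (fun x => x + _) (spray_derive (phi q) Uq))
  (derive_concurrent_energy Uq).
Qed.

Lemma near_derive_pairing q (w : pivec) : U q -> \forall y \near q,
  'D_(gam w) pairing y = metric E y (phi y) w.
Proof.
move=> Uq; apply: (open_near_eq oU Uq) => y; rewrite inE.
exact: derive_pairing_ver.
Qed.

Lemma derive2_pairing q (w : pivec) v : U q ->
  'D_v ('D_(gam w) pairing) q =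
  'D_(hor (rho v)) (fun y => metric E y (phi y) w) q.
Proof.
move=> Uq; apply: (etrans (near_eq_derive _ (near_derive_pairing w Uq))).
apply: (etrans (deriveE _ (differentiable_metric w sphiU Uq))).
exact: diff_metric_phi.
Qed.

Lemma euler_pairing q : U q -> 'D_(Liouville q) pairing q = pairing q.
Proof.
by move=> Uq; rewrite /Liouville (derive_pairing_ver _ Uq) pairing_eta.
Qed.

(** Euler-Lagrange for Phi. The vertical derivatives of Phi are the components of the 1-form g(phi,
    -), which depend on x only. By closedness the derivative of its [b]-component along y is that of
    its y-component along [hor b], and the latter component is Phi. *)
Lemma spray_derive_pairing q (b : pivec) : U q ->
  'D_(G q) ('D_(gam b) pairing) q = 'D_(hor b) pairing q.
Proof.
move=> Uq; apply: (etrans (derive2_pairing _ _ Uq)); rewrite rho_spray //.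
rewrite metric_phi_closed //.
have [de _] := derive_eta q 0; have [dg _] := derive_gam 0 de.
have [_ Ee] := derive_eta q (hor b).
have [_ Eg] := derive_gam (hor b) de.
have {}Eg : 'D_(hor b) (gam \o eta) q = 0.
  by apply: (etrans Eg); rewrite Ee eta_hor gam0.
have sP := smooth_pairing.
have [||_ e] := derive_along oU Uq dg (f := pairing) Eg.
- by move=> y; exact: smooth_differentiable.
- by move=> w; exact: smooth_differentiable (smooth_derive w sP) Uq.
have nP : \forall y \near q, 'D_((gam \o eta) y) pairing y = pairing y.
  by apply: (open_near_eq oU Uq) => y; rewrite inE; exact: euler_pairing.
have {}e := etrans (esym (near_eq_derive _ nP)) e.
rewrite e derive0 addr0; symmetry; apply: (etrans (derive2_pairing _ _ Uq)).
by rewrite rho_hor.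
Qed.

End ConcurrentField.
(** * The change of energy *)

Section MaximalRank.
Context {R : realType} {n : nat}.
Local Notation pt := 'rV[R]_(n + n).
Variables (U : set pt) (E : pt -> R).
Hypotheses (oU : open U) (sE : smooth_on U E).

(** Symmetry of second derivatives moves [u] into the argument of the differentials, which shows
    linearity in [u]. *)
Lemma ddJ_diff q (u a : pt) : U q ->
  ddJ E q u a = 'd ('D_(Jv a) E) q u - 'd ('D_a E) q (Jv u).
Proof.
move=> Uq; apply: (etrans (ddJE oU sE u a Uq)).
have dE y : differentiable ('D_y E) q := smooth_diff_derive sE y Uq.
exact: (congr2 (fun s t => s - t) (deriveE u (dE _))
  (etrans (derive2C oU sE _ _ Uq) (deriveE (Jv u) (dE _)))).
Qed.

Lemma ddJ_inj q (u v : pt) : U q -> maximal_rank (ddJ E q) ->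
  (forall a, ddJ E q u a = ddJ E q v a) -> u = v.
Proof.
move=> Uq rk uv; pose M := \matrix_(i, j) ddJ E q (delta_mx 0 i) (delta_mx 0 j).
have freeM : row_free M by apply/eqP.
(* The matrix of J acting on row vectors. *)
pose JM : 'M[R]_(n + n) := col_mx 1%:M 0 *m row_mx 0 1%:M.
have JE (x : pt) : Jv x = x *m JM.
  rewrite /Jv gamE mulmxA -{2}(hsubmxK x) mul_row_col mulmx1 mulmx0 addr0.
  by [].
have linE (f g : {linear pt -> R}) (x : pt) : f x - g (Jv x) =
    \sum_i x 0 i * (f (delta_mx 0 i) - g (Jv (delta_mx 0 i))).
  have fE : f x = \sum_i x 0 i * f (delta_mx 0 i).
    rewrite {1}(row_sum_delta x) linear_sum; apply: eq_bigr => i _.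
    by rewrite linearZ.
  have gE : g (Jv x) = \sum_i x 0 i * g (Jv (delta_mx 0 i)).
    rewrite JE {1}(row_sum_delta x) mulmx_suml linear_sum.
    by apply: eq_bigr => i _; rewrite -scalemxAl linearZ JE.
  by rewrite fE gE -sumrB; apply: eq_bigr => i _; rewrite mulrBr.
have ddJM x j : (x *m M) 0 j = ddJ E q x (delta_mx 0 j).
  rewrite mxE (ddJ_diff x _ Uq) linE; apply: eq_bigr => i _.
  by rewrite mxE (ddJ_diff _ _ Uq).
suff : (u - v) *m M = 0.
  by move/eqP; rewrite mulmx_free_eq0 // subr_eq0 => /eqP.
apply/rowP => j; rewrite mulmxBl [LHS]mxE [X in _ + X]mxE !ddJM uv subrr.
by rewrite mxE.
Qed.

End MaximalRank.

(** * Derivatives of the energy of the Matsumoto metric *)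

Section Matsumoto.
Context {R : realType} {n : nat}.
Local Notation pt := 'rV[R]_(n + n).
Local Notation vec := 'rV[R]_(n + n).
Local Notation pivec := 'rV[R]_n.
Local Notation eta := Defs.eta.

Definition Ehat (F P : pt -> R) (q : pt) : R :=
  2^-1 * (F q ^+ 2 / (F q - P q)) ^+ 2.

Variables (U : set pt) (F P : pt -> R).
Hypotheses (oU : open U) (sF : smooth_on U F) (sP : smooth_on U P).
Hypothesis FP : forall q, U q -> F q - P q != 0.

Lemma is_derive_exp (V : normedModType R) (f : V -> R) x v df k :
  is_derive x v f df ->
  is_derive x v (fun y => f y ^+ k.+1) (k.+1%:R * f x ^+ k * df).
Proof.
move=> fx; elim: k => [|k IHk].
  by rewrite expr0 mulr1 mul1r; apply: (is_derive_eq fx).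
have -> : (fun y => f y ^+ k.+2) = (fun y => f y * f y ^+ k.+1).
  by apply/funext => y; rewrite exprS.
apply: (is_derive_eq (is_derive_mul fx IHk)); rewrite exprS [in RHS]mulrS; ring.
Qed.

(** Treating the reciprocal as a separate function makes the derivatives of [Ehat] polynomial in
    [F], [T] and derivatives of [F] and [P]. *)
Let T q := (F q - P q)^-1.

Let dF q v : U q -> is_derive q v F ('D_v F q).
Proof.
by move=> Uq; apply/derivableP/diff_derivable/(smooth_differentiable sF).
Qed.

Let dP q v : U q -> is_derive q v P ('D_v P q).
Proof.
by move=> Uq; apply/derivableP/diff_derivable/(smooth_differentiable sP).
Qed.

Let dT q v : U q -> is_derive q v T (- T q ^+ 2 * ('D_v F q - 'D_v P q)).
Proof.
move=> Uq; have dS := is_derive_sub (dF v Uq) (dP v Uq).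
apply: (is_derive_eq (is_derive_inv (f := fun y => F y - P y) (FP Uq) dS)).
by rewrite /T exprVn.
Qed.

Lemma is_derive_Ehat q v : U q -> is_derive q v (Ehat F P)
  ((2 * F q ^+ 3 * T q ^+ 2 - F q ^+ 4 * T q ^+ 3) * 'D_v F q
   + F q ^+ 4 * T q ^+ 3 * 'D_v P q).
Proof.
move=> Uq.
have dK := is_derive_sqr (is_derive_mul (is_derive_sqr (dF v Uq)) (dT v Uq)).
apply: (is_derive_eq (is_derive_mul (is_derive_cst (2^-1 : R) q v) dK)).
rewrite /cst; move: ('D_v F q) ('D_v P q) (F q) (T q) => Fv Pv f t; by field.
Qed.

Lemma derive2_Ehat q u v : U q ->
  'D_v ('D_u (Ehat F P)) q =
  (6 * F q ^+ 2 * T q ^+ 2 * 'D_v F q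
   - 4 * F q ^+ 3 * T q ^+ 3 * ('D_v F q - 'D_v P q)
   - 4 * F q ^+ 3 * T q ^+ 3 * 'D_v F q
   + 3 * F q ^+ 4 * T q ^+ 4 * ('D_v F q - 'D_v P q)) * 'D_u F q
  + (2 * F q ^+ 3 * T q ^+ 2 - F q ^+ 4 * T q ^+ 3) * 'D_v ('D_u F) q
  + (4 * F q ^+ 3 * T q ^+ 3 * 'D_v F q
     - 3 * F q ^+ 4 * T q ^+ 4 * ('D_v F q - 'D_v P q)) * 'D_u P q
  + F q ^+ 4 * T q ^+ 3 * 'D_v ('D_u P) q.
Proof.
move=> Uq.
have nE : \forall y \near q,
    (2 * F y ^+ 3 * T y ^+ 2 - F y ^+ 4 * T y ^+ 3) * 'D_u F y
    + F y ^+ 4 * T y ^+ 3 * 'D_u P y = 'D_u (Ehat F P) y.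
  apply: (open_near_eq oU Uq) => y; rewrite inE => Uy.
  by have [_ ->] := is_derive_Ehat u Uy.
apply: (etrans (esym (near_eq_derive v nE))).
have d2 (f : pt -> R) : smooth_on U f ->
    is_derive q v ('D_u f) ('D_v ('D_u f) q).
  move=> sf; apply/derivableP/diff_derivable.
  exact: smooth_differentiable (smooth_derive u sf) Uq.
have fF k := is_derive_exp k (dF v Uq); have fT k := is_derive_exp k (dT v Uq).
have d43 := is_derive_mul (fF 3%N) (fT 2%N).
have d32 := is_derive_mul
  (is_derive_mul (is_derive_cst (2 : R) q v) (fF 2%N)) (fT 1%N).
have d := is_deriveD (is_derive_mul (is_derive_sub d32 d43) (d2 F sF))
  (is_derive_mul d43 (d2 P sP)).
have [_ ->] := d; rewrite /cst.
move: ('D_v F q) ('D_v P q) => Fv Pv.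
move: ('D_v ('D_u F) q) ('D_v ('D_u P) q) => Fvu Pvu.
move: ('D_u F q) ('D_u P q) (F q) (T q) => Fu Pu f t; ring.
Qed.

(** The Euler-Lagrange equation of [Ehat] at one point. Here [f], [p] are the values of F and Phi;
    the suffixes [x] and [b] denote derivatives along [hor b] and [gam b], and [v] those along the
    asserted spray, so [fvb] is the derivative of D_(gam b) F along it. The corresponding derivative
    for Phi is [px]. *)
Lemma spray_identity (f p p2 fx px fb pb : R) : f != 0 -> f - p != 0 ->
    f * (1 + 2 * p2) - 3 * p != 0 ->
  let t := (f - p)^-1 in
  let f1 := f * (4 * p - f) / (f * (1 + 2 * p2) - 3 * p) in
  let f2 := 2 * f ^+ 3 / (f * (1 + 2 * p2) - 3 * p) in
  let fv := - f1 * f + f2 * (p / f) in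
  let pv := - f ^+ 2 - f1 * p + f2 * p2 in
  let fvb := fx + f2 * ((pb - p / f * fb) / f) in
  (6 * f ^+ 2 * t ^+ 2 * fv - 4 * f ^+ 3 * t ^+ 3 * (fv - pv)
   - 4 * f ^+ 3 * t ^+ 3 * fv + 3 * f ^+ 4 * t ^+ 4 * (fv - pv)) * fb
  + (2 * f ^+ 3 * t ^+ 2 - f ^+ 4 * t ^+ 3) * fvb
  + (4 * f ^+ 3 * t ^+ 3 * fv - 3 * f ^+ 4 * t ^+ 4 * (fv - pv)) * pb
  + f ^+ 4 * t ^+ 3 * px =
  (2 * f ^+ 3 * t ^+ 2 - f ^+ 4 * t ^+ 3) * fx + f ^+ 4 * t ^+ 3 * px.
Proof.
move=> f0 fp d0 /=; field.
by rewrite f0 fp d0.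
Qed.

End Matsumoto.

(** * The spray equation in one chart *)

Section LocalSpray.
Context {R : realType} {n : nat}.
Local Notation pt := 'rV[R]_(n + n).
Local Notation vec := 'rV[R]_(n + n).
Local Notation pivec := 'rV[R]_n.
Local Notation eta := Defs.eta.

Variables (U U1 : set pt) (F P : pt -> R) (G : pt -> vec) (phi : pt -> pivec).
Let E q : R := 2^-1 * F q ^+ 2.
Hypotheses (oU : open U) (sUU1 : U `<=` U1).
Hypotheses (sF : smooth_on U F) (sG : smooth_on U G) (sphi : smooth_on U1 phi).
Hypothesis homF : forall q t, U q -> 0 < t ->
  F (q + (t - 1) *: Liouville q) = t * F q.
Hypothesis JG : forall q, U q -> Jv (G q) = Liouville q.
Hypothesis sprayG : forall q a, U q -> ddJ E q (G q) a = - 'd E q a.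
Hypothesis conc : concurrent_on G U1 E phi.
Hypothesis PE : forall q, U q -> 'D_(gam (phi q)) E q = P q.
Hypothesis FP : forall q, U q -> P q < F q.
Hypothesis sEhat : smooth_on U (Ehat F P).
Hypothesis homEhat : forall q t, U q -> 0 < t ->
  Ehat F P (q + (t - 1) *: Liouville q) = t ^+ 2 * Ehat F P q.

Let sE : smooth_on U E := smooth_half_square oU sF.

Let homE q t : U q -> 0 < t ->
  E (q + (t - 1) *: Liouville q) = t ^+ 2 * E q.
Proof. by move=> Uq t0; rewrite /E homF // exprMn mulrCA. Qed.

Let FP0 q : U q -> F q - P q != 0.
Proof. by move=> Uq; rewrite subr_eq0 gt_eqF // FP. Qed.

Lemma derive_half_square q v : U q -> 'D_v E q = F q * 'D_v F q.
Proof.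
move=> Uq.
have dF := derivableP
  (@diff_derivable _ _ _ F q v (smooth_differentiable sF Uq)).
have [_ e] := is_derive_mul (is_derive_cst (2^-1 : R) q v) (is_derive_sqr dF).
by apply: (etrans e); rewrite /cst; move: ('D_v F q) (F q) => x y; by field.
Qed.

Lemma derive2_half_square q u v : U q ->
  'D_v ('D_u E) q = 'D_v F q * 'D_u F q + F q * 'D_v ('D_u F) q.
Proof.
move=> Uq.
have nE : \forall y \near q, F y * 'D_u F y = 'D_u E y.
  apply: (open_near_eq oU Uq) => y; rewrite inE => Uy.
  exact: (esym (derive_half_square u Uy)).
apply: (etrans (esym (near_eq_derive v nE))).
have dF := derivableP
  (@diff_derivable _ _ _ F q v (smooth_differentiable sF Uq)).
have d2F := derivableP (@diff_derivable _ _ _ ('D_u F) q v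
  (smooth_differentiable (smooth_derive u sF) Uq)).
by have [_ e] := is_derive_mul dF d2F.
Qed.

(** Since Phi = F D_(gam phi) F, a zero of F would be a zero of Phi, against Phi < F. *)
Let F0 q : U q -> F q != 0.
Proof.
move=> Uq; have := FP Uq; rewrite -(PE Uq) (derive_half_square _ Uq).
by apply: contraTneq => ->; rewrite mul0r ltxx.
Qed.

Let sP : smooth_on U P.
Proof.
have sp := smooth_pairing oU sUU1 sE sphi.
by move=> k; apply: Ck_eq (sp k) => // q; rewrite inE => Uq; rewrite -PE.
Qed.

Let derive_P q v : U q -> 'D_v P q = 'D_v (pairing E phi) q.
Proof.
move=> Uq; apply: near_eq_derive; apply: (open_near_eq oU Uq) => y.
by rewrite inE => Uy; rewrite -PE.
Qed.

Let derive2_P q u v : U q -> 'D_v ('D_u P) q = 'D_v ('D_u (pairing E phi)) q.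
Proof.
move=> Uq; apply: near_eq_derive; apply: (open_near_eq oU Uq) => y.
by rewrite inE => Uy; rewrite derive_P.
Qed.

Lemma derive_lincomb (f : pt -> R) q (u v w : vec) (s t : R) :
  differentiable f q ->
  'D_(u - s *: v + t *: w) f q = 'D_u f q - s * 'D_v f q + t * 'D_w f q.
Proof.
move=> df.
have lin (g : {linear vec -> R}) :
    g (u - s *: v + t *: w) = g u - s * g v + t * g w.
  by rewrite linearD linearB !linearZ.
apply: (etrans (deriveE _ df)); apply: (etrans (lin _)).
by congr (_ - _ * _ + _ * _); rewrite -(deriveE _ df).
Qed.

Variables (p : pt).
Hypothesis Up : U p.
Let p2 := metric E p (phi p) (phi p).
Let den := F p * (1 + 2 * p2) - 3 * P p.
Hypothesis den0 : den != 0.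
Let f1 := F p * (4 * P p - F p) / den.
Let f2 := 2 * F p ^+ 3 / den.
Let Gc : vec := G p - f1 *: Liouville p + f2 *: gam (phi p).

Lemma lagrange_Ehat (b : pivec) :
  'D_Gc ('D_(gam b) (Ehat F P)) p = 'D_(hor b) (Ehat F P) p.
Proof.
have f0 := F0 Up; have fp0 := FP0 Up.
have dF := smooth_differentiable sF Up; have dP := smooth_differentiable sP Up.
have dFb := smooth_differentiable (smooth_derive (gam b) sF) Up.
have dPb := smooth_differentiable (smooth_derive (gam b) sP) Up.
(* The derivatives of [F] are read off from those of E = F^2 / 2, after multiplication by the
   nonzero [F p]. *)
have FG : 'D_(G p) F p = 0.
  apply: (mulfI f0); rewrite mulr0.
  exact: etrans (esym (derive_half_square _ Up)) (spray_energy oU sE sprayG Up).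
have FGb : 'D_(G p) ('D_(gam b) F) p = 'D_(hor b) F p.
  apply: (mulfI f0); rewrite -[LHS]add0r -(mul0r ('D_(gam b) F p)) -{1}FG.
  apply: (etrans (esym (derive2_half_square _ _ Up))).
  exact: etrans (spray_derive oU sE homE JG sprayG b Up)
    (derive_half_square _ Up).
have FL : 'D_(Liouville p) F p = F p.
  apply: (mulfI f0).
  apply: (etrans (esym (derive_half_square _ Up))).
  apply: (etrans (euler sE homE Up)); rewrite /E; by field.
(* g(eta, b) is F D_(gam b) F plus F times the unknown, and by homogeneity it equals D_(gam b) E = F
   D_(gam b) F. *)
have FLb : 'D_(Liouville p) ('D_(gam b) F) p = 0.
  apply: (mulfI f0); apply: (addrI (F p * 'D_(gam b) F p)).
  rewrite mulr0 addr0 -{1}FL.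
  apply: (etrans (esym (derive2_half_square _ _ Up))).
  apply: (etrans _ (derive_half_square _ Up)).
  apply: (etrans (esym (metricE oU sE _ _ Up))).
  apply: (etrans (metricC oU sE _ _ Up)).
  exact: (metric_eta oU sE homE _ Up).
have Fphi : 'D_(gam (phi p)) F p = P p / F p.
  apply: (mulfI f0); rewrite mulrCA mulfV // mulr1 -(PE Up).
  exact: esym (derive_half_square _ Up).
have pver w : 'D_(gam w) P p = metric E p (phi p) w.
  exact: etrans (derive_P _ Up)
    (derive_pairing_ver oU sUU1 sE sG sphi JG conc w Up).
(* Phi is affine on each fibre, its vertical derivatives being independent of y. *)
have P2ver w : 'D_(gam w) ('D_(gam b) P) p = 0.
  apply: (etrans (derive2_P _ _ Up)).
  apply: (etrans (derive2_pairing oU sUU1 sE sG sphi JG conc b (gam w) Up)).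
  have -> : hor (rho (gam w)) = 0 by rewrite rho_gam; exact: row_mx0.
  exact: derive0.
(* The Hessian of F^2 / 2 on (phi, b) is g(phi, b), which is also the derivative of Phi along
   [gam b]; solving for the second derivative of [F] gives the value. *)
have Fphib : 'D_(gam (phi p)) ('D_(gam b) F) p =
    ('D_(gam b) P p - P p / F p * 'D_(gam b) F p) / F p.
  apply: (mulfI f0); rewrite [RHS]mulrCA mulfV // mulr1 pver -Fphi.
  apply/eqP; rewrite eq_sym subr_eq; apply/eqP.
  apply: (etrans _ (addrC _ _)).
  apply: (etrans _ (derive2_half_square _ _ Up)).
  exact: (metricE oU sE _ _ Up).
have PG : 'D_(G p) P p = - F p ^+ 2.
  apply: (etrans (derive_P _ Up)).
  apply: (etrans (spray_pairing oU sUU1 sE sG sphi homE JG sprayG conc Up)).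
  by rewrite /E; by field.
have PGb : 'D_(G p) ('D_(gam b) P) p = 'D_(hor b) P p.
  apply: (etrans (derive2_P _ _ Up)).
  apply: (etrans (spray_derive_pairing oU sUU1 sE sG sphi homE JG conc b Up)).
  exact: esym (derive_P _ Up).
have PL : 'D_(Liouville p) P p = P p.
  apply: (etrans (derive_P _ Up)).
  apply: (etrans (euler_pairing oU sUU1 sE sG sphi homE JG conc Up)).
  exact: PE.
have Fv : 'D_Gc F p = - f1 * F p + f2 * (P p / F p).
  apply: (etrans (derive_lincomb _ _ _ _ _ dF)).
  by rewrite FG FL Fphi sub0r mulNr.
have Pv : 'D_Gc P p = - F p ^+ 2 - f1 * P p + f2 * p2.
  apply: (etrans (derive_lincomb _ _ _ _ _ dP)).
  by rewrite PG PL pver.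
have Fvb : 'D_Gc ('D_(gam b) F) p = 'D_(hor b) F p +
    f2 * (('D_(gam b) P p - P p / F p * 'D_(gam b) F p) / F p).
  apply: (etrans (derive_lincomb _ _ _ _ _ dFb)).
  by rewrite FGb FLb Fphib mulr0 subr0.
have Pvb : 'D_Gc ('D_(gam b) P) p = 'D_(hor b) P p.
  apply: (etrans (derive_lincomb _ _ _ _ _ dPb)).
  by rewrite PGb !P2ver !mulr0 subr0 addr0.
apply: (etrans (derive2_Ehat oU sF sP FP0 (gam b) Gc Up)).
have [_ ->] := is_derive_Ehat sF sP FP0 (hor b) Up.
rewrite Fv Pv Fvb Pvb.
exact: (spray_identity _ _ _ _ f0 fp0 den0).
Qed.

(** By maximal rank it suffices that [Gc] solves the same equation. For an arbitrary [a], its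
    horizontal part is [lagrange_Ehat], and its vertical part is Euler's identity because J Gc is
    the Liouville vector. *)
Lemma spray_Ehat (g : vec) : maximal_rank (ddJ (Ehat F P) p) ->
  (forall a, ddJ (Ehat F P) p g a = - 'd (Ehat F P) p a) -> g = Gc.
Proof.
move=> rk gE; apply: (ddJ_inj oU sEhat Up rk) => a; rewrite gE.
have rhoGc : Jv Gc = Liouville p.
  have r0 (c : R) (w : pivec) : rho (c *: gam w) = 0.
    by rewrite rhoZ rho_gam scaler0.
  by rewrite -(JG Up) /Jv /Gc rhoD rhoB /Liouville !r0 subr0 addr0.
have dEh := smooth_diff sEhat Up.
have e1 := lagrange_Ehat (rho a).
have e2 := euler_derive oU sEhat homEhat a Up.
have e3 : 'D_a (Ehat F P) p =
    'D_(hor (rho a)) (Ehat F P) p + 'D_(gam (eta a)) (Ehat F P) p.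
  by rewrite -(deriveDr sEhat _ _ Up) -hor_gam.
have alg (x y z h k : R) : x = h -> y = 2 * z - k -> z = h + k -> - z = x - y.
  by move=> -> -> ->; ring.
rewrite -(deriveE a dEh); symmetry.
apply: (etrans (ddJE oU sEhat _ _ Up)); rewrite rhoGc.
exact: esym (alg _ _ _ _ _ e1 e2 e3).
Qed.

End LocalSpray.
(** * Passage between charts *)

Section TangentCharts.
Context {R : realType} {n : nat} (M : smoothManifold R n).
Local Notation eta := Defs.eta.
Local Notation coord := Defs.coord.
Implicit Types (i j : chart M) (x : M) (u : TM M) (v : 'rV[R]_n).

Let codom i : set 'rV[R]_n := coord i @` dom i.

Lemma near_overlap i j x : dom i x -> dom j x ->
  \forall a \near coord i x, (coord i @` (dom i `&` dom j)) a.
Proof.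
move=> ix jx; have ci : codom i (coord i x) by exists x.
have n1 := open_nbhs_nbhs (conj (@codom_open _ _ M i) ci).
have n2 : nbhs (coord i x) (param i @^-1` dom j).
  apply: (param_continuous ci); rewrite (coordK ix).
  exact: open_nbhs_nbhs (conj (@dom_open _ _ M j) jx).
apply: filterS (filterI n1 n2) => a [[y iy <-] /=].
by rewrite (coordK iy) => jy; exists y.
Qed.

(** The chain rule applies to the composite of the two transition maps, which is the identity near
    [coord i x]. *)
Lemma diff_transitionK i j x v : dom i x -> dom j x ->
  'd (coord i \o param j) (coord j x)
    ('d (coord j \o param i) (coord i x) v) = v.
Proof.
move=> ix jx; set f := coord j \o param i; set g := coord i \o param j.
have ox : (coord i @` (dom i `&` dom j)) (coord i x) by exists x.
have oy : (coord j @` (dom j `&` dom i)) (coord j x) by exists x.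
have df : differentiable f (coord i x).
  exact: smooth_differentiable (@transition_smooth _ _ M i j) ox.
have fx : f (coord i x) = coord j x by rewrite /f /= (coordK ix).
have dg : differentiable g (f (coord i x)).
  rewrite fx; exact: smooth_differentiable (@transition_smooth _ _ M j i) oy.
have nid : \forall a \near coord i x, a = (g \o f) a.
  apply: filterS (near_overlap ix jx) => a [y [iy jy] <-].
  by rewrite /g /f /= (coordK iy) (coordK jy).
have did : differentiable (@id 'rV[R]_n) (coord i x) by exact: ex_diff.
have dgf : differentiable (g \o f) (coord i x) by exact: differentiable_comp.
rewrite -fx -[LHS]/(('d g (f (coord i x)) \o 'd f (coord i x)) v) -diff_comp //.
rewrite -(deriveE v dgf); apply: (etrans (esym (near_eq_derive v nid))).
exact: derive_id.
Qed.

Lemma tangent_coord_diff i x v : dom i x ->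
  tangent_coord i x ('d (coord (chart_at x) \o param i) (coord i x) v) = v.
Proof. by move=> ix; exact: diff_transitionK (mem_chart_at x). Qed.

Lemma diff_tangent_coord i x v : dom i x ->
  'd (coord (chart_at x) \o param i) (coord i x) (tangent_coord i x v) = v.
Proof. by move=> ix; exact: (diff_transitionK v (mem_chart_at x) ix). Qed.

Lemma diff_transition_id i x v : dom i x ->
  'd (coord i \o param i) (coord i x) v = v.
Proof.
move=> ix; have ox : (coord i @` (dom i `&` dom i)) (coord i x) by exists x.
have d : differentiable (coord i \o param i) (coord i x).
  exact: smooth_differentiable (@transition_smooth _ _ M i i) ox.
rewrite -(deriveE v d); apply: etrans (derive_id (coord i x) v).
apply: near_eq_derive; apply: filterS (near_overlap ix ix) => a [y [iy _] <-].
by rewrite /= (coordK iy).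
Qed.

Lemma tangent_coord_id x v : tangent_coord (chart_at x) x v = v.
Proof. exact: diff_transition_id (mem_chart_at x). Qed.

Lemma TM_coordK i u : dom i u.1 -> TM_param i (TM_coord i u) = u.
Proof.
case: u => x v /= ix; rewrite /TM_param /TM_coord /= row_mxKl row_mxKr.
by rewrite (coordK ix) diff_tangent_coord.
Qed.

Lemma TM_paramK i q : codom i (lsubmx q) -> TM_coord i (TM_param i q) = q.
Proof.
move=> [x ix xq]; rewrite /TM_param /TM_coord /= -xq (coordK ix).
by rewrite tangent_coord_diff // xq hsubmxK.
Qed.

(** [TM_param] is linear on fibres, so the coordinate form of homogeneity matches scaling in TM. *)
Lemma TM_param_scale i q t :
  TM_param i (q + (t - 1) *: Liouville q) = scale t (TM_param i q).
Proof.
have -> : q + (t - 1) *: Liouville q = row_mx (lsubmx q) (t *: rsubmx q).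
  rewrite -{1}(hsubmxK q) /Liouville /gam /Defs.eta scale_row_mx add_row_mx.
  by rewrite scaler0 addr0 -{1}[rsubmx q]scale1r -scalerDl subrKC.
by rewrite /TM_param /scale /= row_mxKl row_mxKr linearZ.
Qed.

Lemma in_chart_TM_coord i A u : dom i u.1 -> A u -> in_chart i A (TM_coord i u).
Proof.
move=> iu Au; split; last by rewrite /= TM_coordK.
by rewrite row_mxKl; exists u.1.
Qed.

Lemma loc_vfield_chart_at (X : vfield M) u :
  loc_vfield X (TM_chart u) (TM_coord (TM_chart u) u) = X u.
Proof.
rewrite /loc_vfield TM_coordK; last exact: mem_chart_at.
set i := TM_chart u; set p := TM_coord i u.
have cu : codom i (lsubmx p).
  by rewrite row_mxKl; exists u.1 => //; exact: mem_chart_at.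
have nid : \forall q \near p, q = (TM_coord i \o TM_param i) q.
  have nc := open_nbhs_nbhs (conj (@codom_open _ _ M i) cu).
  have cl := differentiable_continuous (@differentiable_lsubmx R 1 n n p).
  have np : nbhs p (lsubmx @^-1` codom i) := cl _ nc.
  by apply: filterS np => q /= cq; rewrite TM_paramK.
have did : differentiable (@id 'rV[R]_(n + n)) p by exact: ex_diff.
have d := near_eq_differentiable nid did.
apply: (etrans (esym (deriveE (X u) d))).
apply: (etrans (esym (near_eq_derive (X u) nid))); exact: derive_id.
Qed.

Lemma loc_pifield_chart_at (W : pifield M) u :
  loc_pifield W (TM_chart u) (TM_coord (TM_chart u) u) = W u.
Proof.
rewrite /loc_pifield TM_coordK; last exact: mem_chart_at.
exact: tangent_coord_id.
Qed.

Lemma TM_param_fibre i x v : dom i x -> TM_param i (row_mx (coord i x) v) =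
  (x, 'd (coord (chart_at x) \o param i) (coord i x) v).
Proof. by move=> ix; rewrite /TM_param row_mxKl row_mxKr (coordK ix). Qed.

(** Transition maps are linear on fibres, so the vertical lines in the two charts trace the same
    curve in TM and [derive_eq_line] applies. *)
Lemma derive_loc_fun (f : TM M -> R) (W : pifield M) i q :
  codom i (lsubmx q) -> let u := TM_param i q in let j := TM_chart u in
  'D_(gam (loc_pifield W i q)) (loc_fun f i) q =
  'D_(gam (W u)) (loc_fun f j) (TM_coord j u).
Proof.
move=> [x ix xq]; have qE : q = row_mx (coord i x) (rsubmx q).
  by rewrite xq hsubmxK.
move: (rsubmx q) qE => y ->{q xq};
rewrite /loc_pifield (TM_param_fibre y ix) /=.
set v := 'd _ _ y; rewrite /TM_chart /TM_coord /= tangent_coord_id.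
apply: derive_eq_line => h; rewrite /loc_fun /=; congr f.
have lin (a w w' : 'rV[R]_n) :
    h *: gam w + row_mx a w' = row_mx a (h *: w + w').
  by rewrite /gam scale_row_mx scaler0 add_row_mx add0r.
rewrite !lin (TM_param_fibre _ ix) (TM_param_fibre _ (mem_chart_at x)).
apply: etrans (congr1 (pair x) (esym (diff_transition_id _ (mem_chart_at x)))).
congr pair; apply: (etrans (linearP _ _ _ _)); congr (_ *: _ + _).
exact: diff_tangent_coord.
Qed.

End TangentCharts.

(** * The function Phi in natural charts *)

Section MetricPairing.
Context {R : realType} {n : nat} (M : smoothManifold R n).
Local Notation coord := Defs.coord.
Variables (D : set (TM M)) (F : TM M -> R) (phi : pifield M).
Hypothesis D_open : TM_open D.
Hypothesis sF : smooth_fun D F.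
Hypothesis homF : forall u t, 0 < t -> F (scale t u) = t * F u.

Lemma loc_fun_scale i q t : 0 < t ->
  loc_fun F i (q + (t - 1) *: Liouville q) = t * loc_fun F i q.
Proof. by move=> t0; rewrite /loc_fun /= TM_param_scale homF. Qed.

Lemma smooth_energy i : smooth_on (in_chart i D) (loc_fun (energy F) i).
Proof.
have h : smooth_on (in_chart i D) (fun q => 2^-1 * loc_fun F i q ^+ 2).
  apply: smooth_half_square (sF i); exact: D_open.
exact h. Qed.

Lemma loc_energy_scale i q t : 0 < t ->
  loc_fun (energy F) i (q + (t - 1) *: Liouville q) =
  t ^+ 2 * loc_fun (energy F) i q.
Proof.
by move=> t0; rewrite /loc_fun /= TM_param_scale /energy homF // exprMn mulrCA.
Qed.

(** [metricM] is evaluated in a chart that varies with the point. Rewriting Phi as a vertical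
    derivative of the energy, independent of the chart, gives a formula valid throughout one fixed
    chart. *)
Lemma metricM_eta i q : in_chart i D q ->
  'D_(gam (loc_pifield phi i q)) (loc_fun (energy F) i) q =
  metricM F phi etaM (TM_param i q).
Proof.
move=> [cq Dq]; apply: (etrans (derive_loc_fun _ _ cq)).
set u := TM_param i q; set j := TM_chart u.
have Dp : in_chart j D (TM_coord j u).
  exact: in_chart_TM_coord (mem_chart_at u.1) Dq.
have hom y t (_ : in_chart j D y) := @loc_energy_scale j y t.
have := metric_eta (@D_open j) (@smooth_energy j) hom (phi u) Dp.
have -> : Defs.eta (TM_coord j u) = etaM u.
  by rewrite /Defs.eta row_mxKr; exact: tangent_coord_id.
by move=> <-.
Qed.

End MetricPairing.

Theorem theorem3p1 (R : realType) (n : nat) (M : smoothManifold R n)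
    (F : TM M -> R) (G : vfield M) (phi : pifield M) :
  finsler F ->
  geodesic_spray slit F G ->
  concurrent F G phi ->
  let Phi : TM M -> R := metricM F phi etaM in
  let p2 : TM M -> R := metricM F phi phi in
  let Fhat : TM M -> R := fun u => F u ^+ 2 / (F u - Phi u) in
  let D : set (TM M) := [set u | slit u /\ F u > Phi u] in
  conic_pseudo_finsler D Fhat ->
  (forall u, D u -> F u * (1 + 2 * p2 u) - 3 * Phi u != 0) ->
  forall Ghat : vfield M,
  geodesic_spray D Fhat Ghat ->
  let f1 : TM M -> R := fun u =>
    F u * (4 * Phi u - F u) / (F u * (1 + 2 * p2 u) - 3 * Phi u) in
  let f2 : TM M -> R := fun u =>
    2 * F u ^+ 3 / (F u * (1 + 2 * p2 u) - 3 * Phi u) in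
  forall u, D u ->
    Ghat u = G u - f1 u *: LiouvilleM u + f2 u *: gamM phi u.
Proof.
move=> [_ sF _ homF _] [sG sprayG] [sphi _ conc] Phi p2 Fhat D.
move=> [[Dslit _ D_open _ _] _ sFhat homFhat rank] den0 Ghat [_ sprayGhat].
move=> f1 f2 u Du; pose i := TM_chart u; pose p := TM_coord i u.
have iu : dom i u.1 := mem_chart_at u.1.
have pu : TM_param i p = u := TM_coordK iu.
have oU : open (in_chart i D) := D_open i.
have Up : in_chart i D p := in_chart_TM_coord iu Du.
have sU : in_chart i D `<=` in_chart i slit.
  by move=> q [cq Dq]; split => //; exact: Dslit.
have sFD : smooth_fun D F.
  move=> j; apply: smooth_subset (sF j) => q [cq Dq]; split => //.
  exact: Dslit.
have sGi : smooth_on (in_chart i D) (loc_vfield G i) := smooth_subset sU (sG i).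
have hom q t : in_chart i D q -> 0 < t ->
    loc_fun F i (q + (t - 1) *: Liouville q) = t * loc_fun F i q.
  by move=> _; exact: loc_fun_scale.
have JG q : in_chart i D q -> Jv (loc_vfield G i q) = Liouville q.
  by move=> /sU /sprayG [].
have spG q a : in_chart i D q ->
    ddJ (loc_fun (energy F) i) q (loc_vfield G i q) a =
    - 'd (loc_fun (energy F) i) q a.
  by move=> /sU /sprayG [_ _]; exact.
have PE q : in_chart i D q ->
    'D_(gam (loc_pifield phi i q)) (loc_fun (energy F) i) q = loc_fun Phi i q.
  exact: metricM_eta.
have FP q : in_chart i D q -> loc_fun Phi i q < loc_fun F i q.
  by move=> [_ []].
(* [Ehat] of the local F and Phi is by computation the local energy of [Fhat]. *)
have sEhat : smooth_on (in_chart i D) (Ehat (loc_fun F i) (loc_fun Phi i)).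
  exact: (@smooth_half_square _ _ _ (loc_fun Fhat i) oU (sFhat i)).
have homEhat q t : in_chart i D q -> 0 < t ->
    Ehat (loc_fun F i) (loc_fun Phi i) (q + (t - 1) *: Liouville q) =
    t ^+ 2 * Ehat (loc_fun F i) (loc_fun Phi i) q.
  move=> [_ Dq] t0; have := homFhat _ _ t0 Dq; rewrite -TM_param_scale => e.
  rewrite -[LHS]/(2^-1 * Fhat (TM_param i (q + (t - 1) *: Liouville q)) ^+ 2).
  by rewrite e exprMn mulrCA.
(* In the chart chosen at the base point of [u], local components at [p] are the stored ones, so the
   local formula becomes the asserted one. *)
have phiu : loc_pifield phi i p = phi u := loc_pifield_chart_at phi u.
have Fu : loc_fun F i p = F u by rewrite /loc_fun /= pu.
have Phiu : loc_fun Phi i p = Phi u by rewrite /loc_fun /= pu.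
have den : loc_fun F i p * (1 + 2 *
    metric (fun q => 2^-1 * loc_fun F i q ^+ 2) p (loc_pifield phi i p)
      (loc_pifield phi i p)) - 3 * loc_fun Phi i p != 0.
  by rewrite Fu Phiu phiu; exact: den0.
have [_ _ gE] := sprayGhat i p Up.
have := spray_Ehat oU sU (sFD i) sGi (sphi i) hom JG spG (conc i) PE FP
  sEhat homEhat Up den (rank i p Up) gE.
rewrite Fu Phiu phiu !loc_vfield_chart_at => ->.
rewrite /Liouville /Defs.eta row_mxKr tangent_coord_id.
by [].
Qed.
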